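(* Let $\mathbf p\in\mathbb Z^2\setminus\{0\}$ and suppose there exists at least one point $\mathbf q\in\mathcal Q(\mathbf p)$, respectively of type $I_+$ or of type $I_-$, where $\mathbf q$ is not parallel to $\mathbf p$. Let $\Gamma\in\mathbb R$ satisfy the normalization condition $\frac{\Gamma(\mathbf q\wedge\mathbf p)}{2\|\mathbf p\|^2}=1$, and consider the steady state $\omega^0(\mathbf x)=\Gamma\cos(\mathbf p\cdot\mathbf x)$, $\mathbf u^0(\mathbf x)=\frac{\Gamma}{\|\mathbf p\|^2}\sin(\mathbf p\cdot\mathbf x)\,\mathbf p^\perp$, with forcing $f=\|\mathbf p\|^2\Gamma\cos(\mathbf p\cdot\mathbf x)$, of the 2D Navier-Stokes equations $\partial_t\omega+\mathbf u\cdot\nabla\omega=\nu\Delta\omega+\nu f$ on $\mathbb T^2$. Then there exist $\nu_0^p>0$ and $\nu_0^m>0$ such that for all $\nu\in(0,\nu_0^p)$ if $\mathbf q$ is of type $I_+$, respectively for all $\nu\in(0,\nu_0^m)$ if $\mathbf q$ is of type $I_-$, this steady state is linearly unstable. In particular, for every $s\ge0$, the operator $L_{B,\mathbf q}$ in $\ell^2_s(\mathbb Z)$ has a positive eigenvalue and therefore $L_B$ in $\ell^2_s(\mathbb Z^2)$ has a positive eigenvalue. Moreover, for all $\nu$ in the respective intervals $(0,\nu_0^p)$ and $(0,\nu_0^m)$: (1) If $\mathbf q$ is of type $I_+$, then $\lambda>0$ is an eigenvalue of $L_{B,\mathbf q}$ with eigenvector $(w_n)$ satisfying the sign property (S$_+$)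 if and only if $\lambda>0$ is a solution of $a_0(\lambda,\nu)+g(\lambda,\nu)=0$. (2) If $\mathbf q$ is of type $I_-$, then $\lambda>0$ is an eigenvalue of $L_{B,\mathbf q}$ with eigenvector $(w_n)$ satisfying the sign property (S$_-$) if and only if $\lambda>0$ is a solution of $a_0(\lambda,\nu)+f(\lambda,\nu)=0$.
   Context: Notation. $\|\cdot\|$ is the Euclidean norm on $\mathbb Z^2$; for $\mathbf p=(p_1,p_2)$, $\mathbf q=(q_1,q_2)$ set $\mathbf p\wedge\mathbf q=p_1q_2-p_2q_1$ and $\mathbf p^\perp=(-p_2,p_1)$. $\nu>0$ is the viscosity. The torus is $\mathbb T^2=\mathbb R^2/(2\pi\mathbb Z)^2$; velocity and vorticity are related by $\mathbf u=(\psi_y,-\psi_x)$, $\omega=\operatorname{curl}\mathbf u=-\Delta\psi$. Point types. For $\mathbf q\in\mathbb Z^2$ let $\Sigma_{\mathbf q}=\{\mathbf q+n\mathbf p:n\in\mathbb Z\}$ and let $\widehat{\mathbf q}$ be the point of smallest norm in $\Sigma_{\mathbf q}$ (if there are two, the point $\mathbf q+n\mathbf p$ with larger $n$). $\mathcal Q(\mathbf p)=\{\widehat{\mathbf q}:\mathbf q\in\mathbb Z^2\}$. Let $\mathbf q\in\mathcal Q(\mathbf p)$ (so $\mathbf q=\widehat{\mathbf q}$) be the only point of $\Sigma_{\mathbf q}$ in the open disk of radius $\|\mathbf p\|$ centered at $0$. It is of type $I_+$ if $\|\mathbf q+\mathbf p\|=\|\mathbf p\|$, and of type $I_-$ if $\|\mathbf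 q-\mathbf p\|=\|\mathbf p\|$. Operators. $\beta(\mathbf p,\mathbf q)=\frac12(\|\mathbf q\|^{-2}-\|\mathbf p\|^{-2})(\mathbf p\wedge\mathbf q)$ if $\mathbf p,\mathbf q\ne0$, and $\beta(\mathbf p,\mathbf q)=0$ otherwise. The linearization at the steady state, $L_B\omega=-\mathbf u^0\cdot\nabla\omega-\mathbf u\cdot\nabla\omega^0+\nu\Delta\omega$, is in Fourier coefficients the operator $$L_B:(\omega_{\mathbf k})_{\mathbf k\in\mathbb Z^2}\mapsto\big(\beta(\mathbf p,\mathbf k-\mathbf p)\Gamma\omega_{\mathbf k-\mathbf p}-\beta(\mathbf p,\mathbf k+\mathbf p)\Gamma\omega_{\mathbf k+\mathbf p}-\nu\|\mathbf k\|^2\omega_{\mathbf k}\big)_{\mathbf k\in\mathbb Z^2}.$$ Its restriction to sequences supported on $\Sigma_{\mathbf q}$, with $w_n=\omega_{\mathbf q+n\mathbf p}$, is (under the normalization of $\Gamma$) $$L_{B,\mathbf q}:(w_n)_{n\in\mathbb Z}\mapsto(\rho_{n-1}w_{n-1}-\rho_{n+1}w_{n+1}-\nu\|\mathbf q+n\mathbf p\|^2w_n)_{n\in\mathbb Z},\qquad \rho_n=\Gamma\beta(\mathbf p,\mathbf q+n\mathbf p)=1-\frac{\|\mathbf p\|^2}{\|\mathbf q+n\mathbf p\|^2}.$$ These unbounded operators are taken with their natural (maximal) domains. $\ell^2_s(\mathbb Z)$ is the space of sequences with $\sum_n(1+n^{2s})|w_n|^2<\infty$; $\ell^2_s(\mathbb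 Z^2)$ is the space with $\sum_{\mathbf k}(1+\|\mathbf k\|^{2s})|\omega_{\mathbf k}|^2<\infty$. The steady state is called linearly unstable if the linearized operator $L_B$ has an eigenvalue with positive real part. Continued fractions. $[c_1;c_2;\ldots]=\cfrac{1}{c_1+\cfrac{1}{c_2+\cdots}}$ denotes the limit of the truncations. $a_n(\lambda,\nu)=\frac{\lambda+\nu\|\mathbf q+n\mathbf p\|^2}{\rho_n}$ whenever $\rho_n\neq0$. For type $I_+$: $\rho_0<0$, $\rho_1=0$, $\rho_n>0$ for $n\ne0,1$, and $g(\lambda,\nu)=[a_{-1};a_{-2};\ldots]$. For type $I_-$: $\rho_0<0$, $\rho_{-1}=0$, $\rho_n>0$ for $n\neq0,-1$, and $f(\lambda,\nu)=[a_1;a_2;\ldots]$. (The function $f(\lambda,\nu)$ is distinct from the forcing $f$.) Sign property (S$_+$): either $w_n=0$ for $n>1$, $w_1>0$, $w_n<0$ for $n=-1,0$, and $(-1)^{|n|}w_n>0$ for $n\le-2$; or the entries of $(-w_n)$ satisfy these. Sign property (S$_-$): either $w_n=0$ for $n<-1$, $w_n<0$ for $n=-1,0$, and $w_n>0$ for $n>0$; or the entries of $(-w_n)$ satisfy these. *)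

(* Defs.v *)
From HB Require Import structures.
From mathcomp Require Import all_boot all_order all_algebra.
From mathcomp Require Import all_classical all_reals all_analysis.
From mathcomp Require Import complex.
From mathcomp Require Import ring.

Set Implicit Arguments.
Unset Strict Implicit.
Unset Printing Implicit Defensive.

Import Order.TTheory GRing.Theory Num.Theory.
Import numFieldNormedType.Exports.

Local Open Scope classical_set_scope.
Local Open Scope ring_scope.
Local Open Scope complex_scope.

Notation Z2 := (int * int)%type.

(** * Lattice points *)

Definition wedge (p q : Z2) : int := p.1 * q.2 - p.2 * q.1.

Section Lattice.
Variable R : realType.

Definition enorm (k : Z2) : R := Num.sqrt (k.1%:~R ^+ 2 + k.2%:~R ^+ 2).

Definition parallel (p q : Z2) : Prop :=
  exists t : R, q.1%:~R = t * p.1%:~R /\ q.2%:~R = t * p.2%:~R.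

Definition Sigma (p q : Z2) : set Z2 := [set r | exists n : int, r = q + p *~ n].

(* [is_hat p q r]: r is the point of smallest norm in Sigma_q, the one with the
   larger n being retained in case of a tie. *)
Definition is_hat (p q r : Z2) : Prop :=
  exists n : int, r = q + p *~ n /\
    forall m : int, enorm r <= enorm (q + p *~ m) /\
      (enorm (q + p *~ m) = enorm r -> m <= n).

Definition Qset (p : Z2) : set Z2 := [set r | exists q : Z2, is_hat p q r].

Definition type_I (p q : Z2) : Prop :=
  Qset p q /\
  forall r, (Sigma p q r /\ enorm r < enorm p) <-> r = q.

Definition type_Iplus (p q : Z2) : Prop :=
  type_I p q /\ enorm (q + p) = enorm p.

Definition type_Iminus (p q : Z2) : Prop :=
  type_I p q /\ enorm (q - p) = enorm p.

End Lattice.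

(** * Steady states of the Navier-Stokes equations on the torus *)

Section Physical.
Variable R : realType.

(* Functions on the torus are represented by functions of (x, y) which are
   2 pi-periodic in each variable. *)
Definition periodic (w : R -> R -> R) : Prop :=
  forall x y, w (x + 2 * pi) y = w x y /\ w x (y + 2 * pi) = w x y.

Definition dx (w : R -> R -> R) : R -> R -> R :=
  fun x y => derive1 (fun t => w t y) x.
Definition dy (w : R -> R -> R) : R -> R -> R :=
  fun x y => derive1 (w x) y.
Definition lap (w : R -> R -> R) : R -> R -> R :=
  fun x y => dx (dx w) x y + dy (dy w) x y.

(* All iterated partial derivatives up to order n exist, so that dx and dy
   above never take a junk value. *)
Fixpoint has_partials (n : nat) (w : R -> R -> R) : Prop :=
  if n is m.+1 then
    [/\ forall x y, derivable (fun t => w t y) x 1 /\ derivable (w x) y 1,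
        has_partials m (dx w) & has_partials m (dy w)]
  else True.

Definition vel (psi : R -> R -> R) : R -> R -> R * R :=
  fun x y => (dy psi x y, - dx psi x y).
Definition vort (psi : R -> R -> R) : R -> R -> R :=
  fun x y => - lap psi x y.

Definition advect (u : R -> R -> R * R) (w : R -> R -> R) : R -> R -> R :=
  fun x y => (u x y).1 * dx w x y + (u x y).2 * dy w x y.

Definition steady_state (nu : R) (f : R -> R -> R)
    (u : R -> R -> R * R) (w : R -> R -> R) : Prop :=
  (exists psi, [/\ periodic psi, has_partials 4 psi,
                   u = vel psi & w = vort psi]) /\
  (forall x y, advect u w x y = nu * lap w x y + nu * f x y).

Definition linearization (nu : R) (u0 : R -> R -> R * R) (w0 : R -> R -> R)
    (u : R -> R -> R * R) (w : R -> R -> R) : R -> R -> R :=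
  fun x y => - advect u0 w x y - advect u w0 x y + nu * lap w x y.

Definition phase (k : Z2) (x y : R) : R := k.1%:~R * x + k.2%:~R * y.

Definition omega0 (p : Z2) (Gamma : R) : R -> R -> R :=
  fun x y => Gamma * cos (phase p x y).
Definition u0 (p : Z2) (Gamma : R) : R -> R -> R * R :=
  fun x y => let c := Gamma / enorm R p ^+ 2 * sin (phase p x y) in
             (c * (- p.2)%:~R, c * p.1%:~R).
Definition forcing (p : Z2) (Gamma : R) : R -> R -> R :=
  fun x y => enorm R p ^+ 2 * Gamma * cos (phase p x y).

End Physical.

(** * The linearized operators in Fourier coefficients *)

Section Operators.
Variable R : realType.

Definition beta (p q : Z2) : R :=
  if (p != 0) && (q != 0)
  then 2^-1 * (enorm R q ^- 2 - enorm R p ^- 2) * (wedge p q)%:~R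
  else 0.

Definition LB (p : Z2) (Gamma nu : R) (w : Z2 -> R[i]) : Z2 -> R[i] :=
  fun k => (beta p (k - p) * Gamma)%:C * w (k - p)
         - (beta p (k + p) * Gamma)%:C * w (k + p)
         - (nu * enorm R k ^+ 2)%:C * w k.

Definition rho (p q : Z2) (Gamma : R) (n : int) : R :=
  Gamma * beta p (q + p *~ n).

Definition LBq (p q : Z2) (Gamma nu : R) (w : int -> R[i]) : int -> R[i] :=
  fun n => (rho p q Gamma (n - 1))%:C * w (n - 1)
         - (rho p q Gamma (n + 1))%:C * w (n + 1)
         - (nu * enorm R (q + p *~ n) ^+ 2)%:C * w n.

(* A weighted l^2 space on a countable index set. *)
Definition l2w (I : choiceType) (weight : I -> R) : set (I -> R[i]) :=
  [set w | (\esum_(k in [set: I])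
     (weight k * ComplexField.Normc.normc (w k) ^+ 2)%:E < +oo)%E].

Definition l2Z (s : R) : set (int -> R[i]) :=
  l2w (fun n : int => 1 + `|n%:~R| `^ (2 * s)).

Definition l2Z2 (s : R) : set (Z2 -> R[i]) :=
  l2w (fun k : Z2 => 1 + enorm R k `^ (2 * s)).

(* Maximal domain in the space X of an operator A given by a formula that makes
   sense on all sequences. *)
Definition max_domain (I : Type) (X : set (I -> R[i]))
    (A : (I -> R[i]) -> I -> R[i]) : set (I -> R[i]) :=
  [set w | X w /\ X (A w)].

Definition is_eigenvector (I : Type) (X : set (I -> R[i]))
    (A : (I -> R[i]) -> I -> R[i]) (lam : R[i]) (w : I -> R[i]) : Prop :=
  [/\ max_domain X A w, exists k, w k != 0 & forall k, A w k = lam * w k].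

Definition is_eigenvalue (I : Type) (X : set (I -> R[i]))
    (A : (I -> R[i]) -> I -> R[i]) (lam : R[i]) : Prop :=
  exists w, is_eigenvector X A lam w.

Definition linearly_unstable (s : R) (p : Z2) (Gamma nu : R) : Prop :=
  exists lam : R[i],
    0 < complex.Re lam /\ is_eigenvalue (l2Z2 s) (LB p Gamma nu) lam.

(** * Continued fractions *)

(* cf_trunc c n = [c 0; ...; c n.-1] *)
Fixpoint cf_trunc (c : nat -> R) (n : nat) : R :=
  if n is m.+1 then (c 0 + cf_trunc (fun j => c j.+1) m)^-1 else 0.

Definition cf_converges (c : nat -> R) : Prop := cvgn (cf_trunc c).
Definition cfrac (c : nat -> R) : R := limn (cf_trunc c).

Definition a_ (p q : Z2) (Gamma : R) (n : int) (lam nu : R) : R :=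
  (lam + nu * enorm R (q + p *~ n) ^+ 2) / rho p q Gamma n.

Definition g_coef (p q : Z2) (Gamma lam nu : R) (j : nat) : R :=
  a_ p q Gamma (- j.+1%:Z) lam nu.
Definition f_coef (p q : Z2) (Gamma lam nu : R) (j : nat) : R :=
  a_ p q Gamma j.+1%:Z lam nu.

(* The continued fraction is required to converge, so that its value is not
   the default value of [limn]. *)
Definition solves_plus (p q : Z2) (Gamma nu lam : R) : Prop :=
  cf_converges (g_coef p q Gamma lam nu) /\
  a_ p q Gamma 0 lam nu + cfrac (g_coef p q Gamma lam nu) = 0.
Definition solves_minus (p q : Z2) (Gamma nu lam : R) : Prop :=
  cf_converges (f_coef p q Gamma lam nu) /\
  a_ p q Gamma 0 lam nu + cfrac (f_coef p q Gamma lam nu) = 0.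

(** * Sign properties *)

(* In the order of R[i], 0 < z means that z is real and positive. *)
Definition sign_plus0 (w : int -> R[i]) : Prop :=
  [/\ forall n : int, 1 < n -> w n = 0,
      0 < w 1,
      w (-1) < 0 /\ w 0 < 0
    & forall n : int, n <= -2 -> 0 < (-1) ^+ `|n|%N * w n].
Definition sign_minus0 (w : int -> R[i]) : Prop :=
  [/\ forall n : int, n < -1 -> w n = 0,
      w (-1) < 0 /\ w 0 < 0
    & forall n : int, 0 < n -> 0 < w n].

Definition sign_plus (w : int -> R[i]) : Prop :=
  sign_plus0 w \/ sign_plus0 (fun n => - w n).
Definition sign_minus (w : int -> R[i]) : Prop :=
  sign_minus0 w \/ sign_minus0 (fun n => - w n).

End Operators.

(** * Consistency of [LB] with the linearization *)

Section Consistency.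
Variable R : realType.
Implicit Types (p k : Z2) (A B x y nu Gamma : R).

Definition trig k A B : R -> R -> R :=
  fun x y => A * cos (phase k x y) + B * sin (phase k x y).

Lemma trig_dx k A B x y :
  is_derive x 1 (fun t => trig k A B t y)
    (trig k (k.1%:~R * B) (- (k.1%:~R * A)) x y).
Proof.
have H : is_derive x 1 (fun t => phase k t y) k.1%:~R.
  rewrite /phase; apply: is_derive_eq; rewrite /GRing.scale /=; ring.
have Hc := @is_derive1_comp _ (@cos R) (fun t => phase k t y) x _ _
  (is_derive_cos _) H.
have Hs := @is_derive1_comp _ (@sin R) (fun t => phase k t y) x _ _
  (is_derive_sin _) H.
apply: (is_derive_eq (is_deriveD (is_deriveZ A Hc) (is_deriveZ B Hs))).
by rewrite /trig /GRing.scale /=; ring.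
Qed.

Lemma trig_dy k A B x y :
  is_derive y 1 (trig k A B x)
    (trig k (k.2%:~R * B) (- (k.2%:~R * A)) x y).
Proof.
have H : is_derive y 1 (phase k x) k.2%:~R.
  rewrite /phase; apply: is_derive_eq; rewrite /GRing.scale /=; ring.
have Hc := @is_derive1_comp _ (@cos R) (phase k x) y _ _ (is_derive_cos _) H.
have Hs := @is_derive1_comp _ (@sin R) (phase k x) y _ _ (is_derive_sin _) H.
apply: (is_derive_eq (is_deriveD (is_deriveZ A Hc) (is_deriveZ B Hs))).
by rewrite /trig /GRing.scale /=; ring.
Qed.

Lemma dx_trig k A B :
  dx (trig k A B) = trig k (k.1%:~R * B) (- (k.1%:~R * A)).
Proof.
apply/funext => x; apply/funext => y; rewrite /dx derive1E.
exact: (@derive_val _ _ _ _ _ _ _ (trig_dx k A B x y)).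
Qed.

Lemma dy_trig k A B :
  dy (trig k A B) = trig k (k.2%:~R * B) (- (k.2%:~R * A)).
Proof.
apply/funext => x; apply/funext => y; rewrite /dy derive1E.
exact: (@derive_val _ _ _ _ _ _ _ (trig_dy k A B x y)).
Qed.

Lemma has_partials_trig n k A B : has_partials n (trig k A B).
Proof.
elim: n A B => [//|n IHn] A B /=; split.
- move=> x y; split.
  + exact: (@ex_derive _ _ _ _ _ _ _ (trig_dx k A B x y)).
  + exact: (@ex_derive _ _ _ _ _ _ _ (trig_dy k A B x y)).
- by rewrite dx_trig.
- by rewrite dy_trig.
Qed.

Lemma sqr_enorm k : enorm R k ^+ 2 = k.1%:~R ^+ 2 + k.2%:~R ^+ 2.
Proof. by rewrite sqr_sqrtr // addr_ge0 // sqr_ge0. Qed.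

Lemma sqr_enorm_neq0 k : k != 0 -> enorm R k ^+ 2 != 0.
Proof.
case: k => a b; rewrite sqr_enorm paddr_eq0 ?sqr_ge0 // !sqrf_eq0 /= !intr_eq0.
by apply: contra => /andP[/eqP -> /eqP ->].
Qed.

Lemma lap_trig k A B x y :
  lap (trig k A B) x y = - enorm R k ^+ 2 * trig k A B x y.
Proof. rewrite /lap !dx_trig !dy_trig sqr_enorm /trig; ring. Qed.

(* On a real Fourier mode of wave vector k (k = 0 carries no velocity), the
   linearization is given by the column of index k of the matrix of [LB]. *)
Lemma linearization_trig p k Gamma nu A B : p != 0 -> k != 0 ->
  let psi := trig k (A / enorm R k ^+ 2) (B / enorm R k ^+ 2) in
  let w := trig k A B in
  vort psi = w /\
  forall x y,
    linearization nu (u0 p Gamma) (omega0 p Gamma) (vel psi) w x y =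
      beta R p k * Gamma * trig (k + p) A B x y
      - beta R p k * Gamma * trig (k - p) A B x y
      - nu * enorm R k ^+ 2 * w x y.
Proof.
move=> p0 k0 psi w.
have := sqr_enorm_neq0 p0; rewrite sqrf_eq0 => hp.
have := sqr_enorm_neq0 k0; rewrite sqrf_eq0 => hk.
split.
  apply/funext => x; apply/funext => y.
  by rewrite /vort /psi lap_trig /w /trig; field.
move=> x y.
have -> : omega0 p Gamma = trig p Gamma 0.
  by apply/funext => a; apply/funext => b; rewrite /trig /omega0 mul0r addr0.
rewrite /linearization lap_trig /advect /vel /u0 /psi /w !dx_trig !dy_trig /=.
rewrite /trig /beta p0 k0 /=.
have -> : phase (k + p) x y = phase k x y + phase p x y.
  by rewrite /phase /= !rmorphD /=; ring.
have -> : phase (k - p) x y = phase k x y - phase p x y.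
  by rewrite /phase /= !rmorphB /=; ring.
rewrite cosD cosB sinD sinB /wedge !(rmorphB, rmorphM, rmorphN) /=.
by field; rewrite hp hk.
Qed.

End Consistency.

(* Main.v *)
Require Import Defs.
From HB Require Import structures.
From mathcomp Require Import all_boot all_order all_algebra.
From mathcomp Require Import all_classical all_reals all_analysis.
From mathcomp Require Import complex.
From mathcomp Require Import ring lra zify.

Set Implicit Arguments.
Unset Strict Implicit.
Unset Printing Implicit Defensive.

Import Order.TTheory GRing.Theory Num.Theory.
Import numFieldNormedType.Exports.

Local Open Scope classical_set_scope.
Local Open Scope ring_scope.
Local Open Scope complex_scope.

(** Why the theorem holds.

    On the chain of modes q + n p the operator couples only nearest
    neighbours.  Put Q = |q|^2 and P = |p|^2, so 0 < Q < P.  The type condition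
    fixes the scalar product of p and q, hence all norms on the chain: for type
    I_- one has |q + n p|^2 = P n^2 + Q (1 + n), and for type I_+ the same with n
    replaced by - n.  The reflection u_n |-> (-1)^n u_(-n) exchanges the two
    cases ([chain_op_flip]), so only the first is studied.

    There the weight rho_(-1) vanishes, which cuts the chain: a solution can be
    0 below -1, and on the right half of the chain z_n = rho_n w_n satisfies
    z_(n-1) = a_n z_n + z_(n+1).  The ratios x_n = z_(n+1) / z_n of a positive
    solution obey x_n (a_(n+1) + x_(n+1)) = 1, and the equation at site 0 says
    a_0 + x_0 = 0.  Since the a_n with n >= 1 are bounded below by a positive
    constant, two successive steps of the continued fraction contract
    ([tails_dist]); therefore the fraction converges, is the only positive
    solution of the ratio recursion ([cfrac_uniq]), and is Lipschitz in its
    coefficients ([cfrac_lipschitz]).  Uniqueness turns an eigenvector with the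
    right signs into a root of a_0 + [a_1; a_2; ...]
    ([eigenvector_dispersion_root]).  Conversely, at a root the products of the
    tails form an eigenvector ([dispersion_root_eigenvector]); since
    a_n >= nu P n^2 it decays faster than any power of n, so it lies in every
    weighted space, and extended by 0 to the lattice it is an eigenvector of the
    full operator.

    A root exists by the intermediate value theorem.  For large lambda the term
    a_0, which is negative, wins.  At lambda = 0 the fraction wins when nu is
    small.  There |a_0| is a constant times nu.  If the fraction z_1 / z_0 were
    no larger, the first even z_n would stay close to z_0; but z_1 is the sum of
    the a_n z_n over even n >= 2, and a_n >= nu P, so k of its terms already
    exceed k nu P z_0 / 2, which is too much for large k ([dispersion0_gt0]). *)

(** * Continued fractions with coefficients bounded below *)

Section ContinuedFractions.
Context {R : realType}.
Implicit Types (a b x y : nat -> R) (c e : R).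

(** Two successive tails x, x' of a continued fraction whose coefficients are at
    least c satisfy x x' <= [two_step_rate c] < 1. *)
Definition two_step_rate c : R := (1 + c ^+ 2)^-1.

Let rate_gt0 c : 0 < c -> 0 < two_step_rate c.
Proof. by move=> c0; rewrite invr_gt0 addr_gt0 // exprn_gt0. Qed.

Lemma two_step_rate_lt1 c : 0 < c -> two_step_rate c < 1.
Proof.
move=> c0; have c2 : 0 < c ^+ 2 by rewrite exprn_gt0.
by rewrite invf_lt1; lra.
Qed.

(** One step t |-> 1 / (a + t) need not contract when a is small, but two steps
    do: the difference of two chains of tails is multiplied by
    x_0 x_1 y_0 y_1, which is at most [two_step_rate c].  This single
    estimate gives convergence (e = 0, truncations of different depths),
    uniqueness (e = 0, N to infinity) and continuity (N to infinity). *)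
Lemma tails_dist c e N a b x y : 0 < c ->
  (forall n, c <= a n) -> (forall n, c <= b n) ->
  (forall n, `|a n - b n| <= e) ->
  (forall n, 0 <= x n <= c^-1) -> (forall n, 0 <= y n <= c^-1) ->
  (forall n, (n < N.*2)%N -> x n * (a n + x n.+1) = 1) ->
  (forall n, (n < N.*2)%N -> y n * (b n + y n.+1) = 1) ->
  `|x 0 - y 0| <= (c ^- 2 + 1) / (1 - two_step_rate c) * e + two_step_rate c ^+ N * c^-1.
Proof.
move=> c0; have c2 : 0 < c ^+ 2 by rewrite exprn_gt0.
have t0 := rate_gt0 c0; have t1 := two_step_rate_lt1 c0.
elim: N a b x y => [|N IH] a b x y ca cb ab hx hy xa yb.
  have e0 : 0 <= e by apply: le_trans (ab 0); rewrite normr_ge0.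
  have K0 : 0 <= (c ^- 2 + 1) / (1 - two_step_rate c) * e.
    rewrite mulr_ge0 // divr_ge0 ?subr_ge0 ?(ltW t1) // addr_ge0 //.
    by rewrite invr_ge0 ltW.
  have := hx 0; have := hy 0; rewrite expr0 mul1r ler_norml; lra.
have {}IH : `|x 2 - y 2| <=
    (c ^- 2 + 1) / (1 - two_step_rate c) * e + two_step_rate c ^+ N * c^-1.
  apply: (IH (fun n => a n.+2) (fun n => b n.+2) (fun n => x n.+2)
             (fun n => y n.+2)) => // n nN.
  - by apply: xa; rewrite doubleS.
  - by apply: yb; rewrite doubleS.
have pair (f z : nat -> R) : (forall n, c <= f n) -> (forall n, 0 <= z n) ->
    z 0 * (f 0 + z 1) = 1 -> z 1 * (f 1 + z 2) = 1 -> z 0 * z 1 <= two_step_rate c.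
  move=> cf z0 h0 h1; have := cf 0; have := cf 1; have := z0 0; have := z0 1.
  move=> z10 z00 f1 f0; rewrite /two_step_rate -div1r ler_pdivlMr; last by lra.
  have s1 : z 0 * z 1 * c ^+ 2 <= z 0 * c.
    have : z 1 * c <= 1.
      rewrite -h1 ler_wpM2l //; have := z0 2; lra.
    move=> hh; have -> : z 0 * z 1 * c ^+ 2 = z 0 * c * (z 1 * c) by ring.
    by rewrite -[leRHS]mulr1 ler_wpM2l // mulr_ge0 // ltW.
  have : z 0 * c <= z 0 * f 0 by rewrite ler_wpM2l.
  move: h0; rewrite mulrDr mulrDr mulr1 => h0; lra.
have x0 n : 0 <= x n by case/andP: (hx n).
have y0 n : 0 <= y n by case/andP: (hy n).
have e0 : 0 <= e by apply: le_trans (ab 0); rewrite normr_ge0.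
have xa0 := xa 0%N isT; have yb0 := yb 0%N isT.
have xa1 : x 1 * (a 1 + x 2) = 1 by apply: xa; rewrite doubleS.
have yb1 : y 1 * (b 1 + y 2) = 1 by apply: yb; rewrite doubleS.
have X := pair a x ca x0 xa0 xa1; have Y := pair b y cb y0 yb0 yb1.
have -> : x 0 - y 0 = x 0 * y 0 * (b 0 - a 0)
    + x 0 * y 0 * x 1 * y 1 * (a 1 - b 1)
    + x 0 * y 0 * x 1 * y 1 * (x 2 - y 2).
  have -> : x 0 - y 0 = x 0 * (y 0 * (b 0 + y 1)) - y 0 * (x 0 * (a 0 + x 1)).
    by rewrite xa0 yb0 !mulr1.
  have -> : x 0 * (y 0 * (b 0 + y 1)) - y 0 * (x 0 * (a 0 + x 1)) =
    x 0 * y 0 * (b 0 - a 0) + x 0 * y 0 * (y 1 - x 1) by ring.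
  have -> : y 1 - x 1 = y 1 * (x 1 * (a 1 + x 2)) - x 1 * (y 1 * (b 1 + y 2)).
    by rewrite xa1 yb1 !mulr1.
  by ring.
have XY : x 0 * y 0 * x 1 * y 1 <= two_step_rate c * two_step_rate c.
  have -> : x 0 * y 0 * x 1 * y 1 = (x 0 * x 1) * (y 0 * y 1) by ring.
  by rewrite ler_pM // mulr_ge0.
have XY0 : 0 <= x 0 * y 0 * x 1 * y 1 by rewrite !mulr_ge0.
have xy : x 0 * y 0 <= c ^- 2.
  rewrite -exprVn expr2 ler_pM //; [by case/andP: (hx 0)|by case/andP: (hy 0)].
have tt : two_step_rate c * two_step_rate c <= two_step_rate c by rewrite ler_piMl // ltW.
have T1 : `|x 0 * y 0 * (b 0 - a 0)| <= c ^- 2 * e.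
  rewrite normrM ger0_norm ?mulr_ge0 // ler_pM ?mulr_ge0 //.
  by rewrite distrC.
have T2 : `|x 0 * y 0 * x 1 * y 1 * (a 1 - b 1)| <= 1 * e.
  rewrite normrM ger0_norm // ler_pM //; lra.
have T3 : `|x 0 * y 0 * x 1 * y 1 * (x 2 - y 2)| <=
    two_step_rate c * ((c ^- 2 + 1) / (1 - two_step_rate c) * e + two_step_rate c ^+ N * c^-1).
  by rewrite normrM ger0_norm // ler_pM //; apply: le_trans XY _.
apply: le_trans (ler_normD _ _) _.
apply: le_trans (lerD (ler_normD _ _) (lexx _)) _.
apply: le_trans (lerD (lerD T1 T2) T3) _.
rewrite [leRHS](_ : _ = c ^- 2 * e + 1 * e +
   two_step_rate c * ((c ^- 2 + 1) / (1 - two_step_rate c) * e + two_step_rate c ^+ N / c)) //.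
move: (two_step_rate c) t1 (c ^- 2) (c^-1) => t t1 u v.
by rewrite exprS; field; lra.
Qed.

Lemma cf_trunc_ge0 a n : (forall k, 0 < a k) -> 0 <= cf_trunc a n.
Proof.
elim: n a => [//|n IH] a a0 /=.
by rewrite invr_ge0 addr_ge0 ?(ltW (a0 _)) // IH.
Qed.

Lemma cf_trunc_bounds c a n : 0 < c -> (forall k, c <= a k) ->
  0 <= cf_trunc a n <= c^-1.
Proof.
move=> c0 ca; have a0 k : 0 < a k by apply: lt_le_trans (ca k).
rewrite cf_trunc_ge0 //=; case: n => [|n] /=; first by rewrite invr_ge0 ltW.
have t0 := @cf_trunc_ge0 (fun j => a j.+1) n (fun j => a0 j.+1).
have h := ca 0; rewrite lef_pV2 ?posrE //; lra.
Qed.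

Definition trunc_tail a n j := cf_trunc (fun i => a (j + i)%N) (n - j).

Let trunc_tail_step a n j : (forall k, 0 < a k) -> (j < n)%N ->
  trunc_tail a n j * (a j + trunc_tail a n j.+1) = 1.
Proof.
move=> a0 jn; rewrite /trunc_tail -(subnSK jn) /= addn0.
under [X in cf_trunc X (n - j.+1)]eq_fun do rewrite addnS -addSn.
rewrite mulVf // gt_eqF // ltr_pwDl // cf_trunc_ge0 //.
Qed.

Lemma cf_trunc_dist c e a b n m N : 0 < c ->
  (forall n, c <= a n) -> (forall n, c <= b n) ->
  (forall n, `|a n - b n| <= e) -> (N.*2 <= n)%N -> (N.*2 <= m)%N ->
  `|cf_trunc a n - cf_trunc b m| <=
    (c ^- 2 + 1) / (1 - two_step_rate c) * e + two_step_rate c ^+ N * c^-1.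
Proof.
move=> c0 ca cb ab Nn Nm.
have a0 k : 0 < a k by apply: lt_le_trans (ca k).
have b0 k : 0 < b k by apply: lt_le_trans (cb k).
have -> : cf_trunc a n = trunc_tail a n 0 by rewrite /trunc_tail subn0.
have -> : cf_trunc b m = trunc_tail b m 0 by rewrite /trunc_tail subn0.
apply: (@tails_dist c e N a b (trunc_tail a n) (trunc_tail b m)) => // k.
- exact: cf_trunc_bounds.
- exact: cf_trunc_bounds.
- by move=> kN; apply: trunc_tail_step => //; apply: leq_trans Nn.
- by move=> kN; apply: trunc_tail_step => //; apply: leq_trans Nm.
Qed.

Let two_step_rate_cvg0 c : 0 < c ->
  (fun N => two_step_rate c ^+ N * c^-1) @ \oo --> 0.
Proof.
move=> c0; rewrite -[X in _ --> X](mul0r c^-1).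
apply: cvgMl; apply: cvg_expr.
by rewrite gtr0_norm ?rate_gt0 ?two_step_rate_lt1.
Qed.

Lemma cf_cvg c a : 0 < c -> (forall n, c <= a n) -> cf_converges a.
Proof.
move=> c0 ca; apply/cauchy_cvgP/cauchyP => e e0.
have /cvgrPdist_lt/(_ e e0) [N _ HN] := two_step_rate_cvg0 c0.
exists (cf_trunc a N.*2); exists N.*2 => //= n Nn; rewrite /ball /=.
have := HN N (leqnn _); rewrite /= sub0r normrN => /(le_lt_trans (ler_norm _)).
apply: le_lt_trans.
rewrite -[leRHS]add0r -{1}(mulr0 ((c ^- 2 + 1) / (1 - two_step_rate c))).
by apply: cf_trunc_dist => // k; rewrite subrr normr0.
Qed.

Lemma cfrac_bounds c a : 0 < c -> (forall n, c <= a n) ->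
  0 <= cfrac a <= c^-1.
Proof.
move=> c0 ca; have H := cf_cvg c0 ca.
apply/andP; split.
- apply: limr_ge => //; apply: nearW => n.
  by case/andP: (cf_trunc_bounds n c0 ca).
- apply: limr_le => //; apply: nearW => n.
  by case/andP: (cf_trunc_bounds n c0 ca).
Qed.

Lemma cfrac_step c a : 0 < c -> (forall n, c <= a n) ->
  cfrac a * (a 0 + cfrac (fun n => a n.+1)) = 1.
Proof.
move=> c0 ca; have H := cf_cvg c0 ca.
have ca' n : c <= (fun n => a n.+1) n by apply: ca.
have H' := cf_cvg c0 ca'.
have s0 : a 0 + cfrac (fun n => a n.+1) != 0.
  by have /andP[? _] := cfrac_bounds c0 ca'; have ? := ca 0; rewrite gt_eqF //; lra.
suff -> : cfrac a = (a 0 + cfrac (fun n => a n.+1))^-1 by rewrite mulVf.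
apply: cvg_lim => //; rewrite -(cvg_shiftS (cf_trunc a)) /=.
apply: cvgV => //; apply: cvgD => //; exact: cvg_cst.
Qed.

Lemma cfrac_gt0 c a : 0 < c -> (forall n, c <= a n) -> 0 < cfrac a.
Proof.
move=> c0 ca; have /andP[h _] := cfrac_bounds c0 ca.
rewrite lt_def h andbT; apply/eqP => a0.
by have := cfrac_step c0 ca; rewrite a0 mul0r => /eqP; rewrite eq_sym oner_eq0.
Qed.

Lemma infinite_tails_dist c e a b x y : 0 < c ->
  (forall n, c <= a n) -> (forall n, c <= b n) ->
  (forall n, `|a n - b n| <= e) ->
  (forall n, 0 <= x n <= c^-1) -> (forall n, 0 <= y n <= c^-1) ->
  (forall n, x n * (a n + x n.+1) = 1) ->
  (forall n, y n * (b n + y n.+1) = 1) ->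
  `|x 0 - y 0| <= (c ^- 2 + 1) / (1 - two_step_rate c) * e.
Proof.
move=> c0 ca cb ab hx hy xa yb.
set K := _ * e.
have : (fun N => K + two_step_rate c ^+ N * c^-1) @ \oo --> K.
  rewrite -[X in _ --> X]addr0.
  by apply: cvgD; [exact: cvg_cst|exact: two_step_rate_cvg0].
move=> /cvgr_to_ge; apply; apply: nearW => N.
exact: (@tails_dist c e N a b x y).
Qed.

Lemma cfrac_tail_bounds c a n : 0 < c -> (forall n, c <= a n) ->
  0 <= cfrac (fun i => a (n + i)%N) <= c^-1.
Proof. by move=> c0 ca; apply: cfrac_bounds. Qed.

Lemma cfrac_tail_step c a n : 0 < c -> (forall n, c <= a n) ->
  cfrac (fun i => a (n + i)%N) * (a n + cfrac (fun i => a (n.+1 + i)%N)) = 1.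
Proof.
move=> c0 ca; have := @cfrac_step c (fun i => a (n + i)%N) c0 (fun i => ca _).
by rewrite addn0; under [X in _ + cfrac X]eq_fun do rewrite addnS -addSn.
Qed.

(** The constant depends on c only, so this yields continuity in any parameter
    on which the coefficients depend uniformly. *)
Lemma cfrac_lipschitz c e a b : 0 < c ->
  (forall n, c <= a n) -> (forall n, c <= b n) ->
  (forall n, `|a n - b n| <= e) ->
  `|cfrac a - cfrac b| <= (c ^- 2 + 1) / (1 - two_step_rate c) * e.
Proof.
move=> c0 ca cb ab.
apply: (@infinite_tails_dist c e a b (fun n => cfrac (fun i => a (n + i)%N))
  (fun n => cfrac (fun i => b (n + i)%N))) => // n.
- exact: cfrac_tail_bounds.
- exact: cfrac_tail_bounds.
- exact: (@cfrac_tail_step c).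
- exact: (@cfrac_tail_step c).
Qed.

(** A nonnegative solution of the recursion of the tails is automatically bounded
    by 1 / c, so it stays at a bounded distance from the true tails, and the
    contraction identifies the two. *)
Lemma cfrac_uniq c a x : 0 < c -> (forall n, c <= a n) ->
  (forall n, 0 <= x n) -> (forall n, x n * (a n + x n.+1) = 1) ->
  cfrac a = x 0.
Proof.
move=> c0 ca x0 xa.
have xc n : 0 <= x n <= c^-1.
  rewrite x0 /= -[leRHS]mul1r ler_pdivlMr //.
  rewrite -(xa n) ler_wpM2l //; have := ca n; have := x0 n.+1; lra.
apply/eqP; rewrite -subr_eq0 -normr_le0.
rewrite -[leRHS](mulr0 ((c ^- 2 + 1) / (1 - two_step_rate c))).
apply: (@infinite_tails_dist c 0 a a (fun n => cfrac (fun i => a (n + i)%N)) x)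
  => // n.
- by rewrite subrr normr0.
- exact: cfrac_tail_bounds.
- exact: (@cfrac_tail_step c).
Qed.

End ContinuedFractions.

(** * The three-term recurrence *)

Section Recurrence.
Context {R : realType}.
Implicit Types (c x z : nat -> R).

Lemma prod_tails_recurrence c x : (forall n, x n * (c n + x n.+1) = 1) ->
  let z n := \prod_(i < n) x i in
  forall n, z n = c n * z n.+1 + z n.+2.
Proof.
move=> xc z n; rewrite /z !big_ord_recr /=.
rewrite -[LHS]mulr1 -(xc n); ring.
Qed.

(** Telescoping the recurrence over odd and over even indices gives
    z_0 - z_(2j) = c_0 z_1 + c_2 z_3 + ... and z_1 >= c_1 z_2 + c_3 z_4 + ...,
    where z_1 >= z_3 >= ....  So if the first even coefficients are small the z_(2j)
    remain close to z_0, and each of them contributes m z_(2j) to z_1. *)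
Lemma recurrence_second_ge c z m k : (forall n, z n = c n * z n.+1 + z n.+2) ->
  (forall n, 0 <= z n) -> (forall n, 0 <= c n) -> 0 <= m ->
  (forall n, m <= c n.*2.+1) ->
  k%:R * m * (z 0 - (\sum_(i < k) c i.*2) * z 1) <= z 1.
Proof.
move=> zE z0 c0 m0 mc; set A := \sum_(i < k) _.
have odd_le j : z j.*2.+1 <= z 1.
  elim: j => [//|j IH]; apply: le_trans IH.
  by rewrite doubleS (zE j.*2.+1) lerDr mulr_ge0.
have evenE j : z j.*2 = z 0 - \sum_(i < j) c i.*2 * z i.*2.+1.
  elim: j => [|j IH]; first by rewrite big_ord0 subr0.
  have := zE j.*2; rewrite big_ord_recr /= doubleS; lra.
have even_ge j : (j <= k)%N -> z 0 - A * z 1 <= z j.*2.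
  move=> jk; rewrite evenE lerD2l lerN2.
  apply: (@le_trans _ _ (\sum_(i < j) c i.*2 * z 1)).
    by apply: ler_sum => i _; rewrite ler_wpM2l.
  rewrite -mulr_suml ler_wpM2r // /A (big_ord_widen _ (fun i => c i.*2) jk).
  by rewrite [leRHS](bigID (fun i : 'I_k => (i < j)%N)) /= lerDl sumr_ge0.
have oddE j : z 1 = \sum_(i < j) c i.*2.+1 * z i.*2.+2 + z j.*2.+1.
  elim: j => [|j IH]; first by rewrite big_ord0 add0r.
  have := zE j.*2.+1; rewrite big_ord_recr /= doubleS; lra.
rewrite [leRHS](oddE k); apply: ler_wpDr => //.
apply: (@le_trans _ _ (\sum_(i < k) m * (z 0 - A * z 1))).
  by rewrite sumr_const card_ord -[leRHS]mulr_natl mulrA.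
apply: ler_sum => i _; apply: (@le_trans _ _ (m * z i.*2.+2)).
  by rewrite ler_wpM2l // -doubleS even_ge.
by rewrite ler_wpM2r.
Qed.

End Recurrence.

(** * The half-infinite chain and its dispersion relation *)

Section Chain.
Context {R : realType}.
Variables (P Q : R).
Hypotheses (Q0 : 0 < Q) (QP : Q < P).
Implicit Types (n : int) (lam nu : R).

(** The squared norms of the modes q + n p for a point q of type I_-. *)
Definition chain_norm2 n : R := P * n%:~R ^+ 2 + Q * (1 + n%:~R).

Definition rate (d : int -> R) n : R := 1 - P / d n.

(** The squared norms d are a parameter, so that the same operator describes
    both orientations of the chain. *)
Definition chain_op (d : int -> R) nu (u : int -> R) n : R :=
  rate d (n - 1) * u (n - 1) - rate d (n + 1) * u (n + 1) - nu * d n * u n.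

Definition chain_coef (d : int -> R) lam nu n : R :=
  (lam + nu * d n) / rate d n.

(** With z_n = rate_n u_n and z_0 = 1, this is the defect in the eigenvalue
    equation at the site 0 when z is the decaying solution to the right of it. *)
Definition dispersion lam nu : R :=
  chain_coef chain_norm2 lam nu 0 +
  cfrac (fun j => chain_coef chain_norm2 lam nu j.+1%:Z).

Notation d := chain_norm2.
Notation r := (rate chain_norm2).
Notation a := (chain_coef chain_norm2).

Local Ltac chain_lra := move: Q0 QP; lra.

Let P0 : 0 < P := lt_trans Q0 QP.

Let nuP_gt0 nu : 0 < nu -> 0 < nu * P. Proof. by move=> ?; rewrite mulr_gt0. Qed.

(** For n < -1 the term Q (1 + n) is negative, and Q < P bounds the norm below by
    P (n^2 + n + 1). *)
Lemma chain_norm2_gt0 n : 0 < d n.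
Proof.
rewrite /d; move: (n%:~R : R) => y.
have [y1|y1] := lerP (-1) y.
  have [->|/eqP y0] := y =P 0.
    by rewrite expr2 !mulr0 addr0 mulr1 add0r.
  apply: ltr_wpDr; last by rewrite mulr_gt0 // exprn_even_gt0.
  by rewrite mulr_ge0 //; chain_lra.
have : 0 <= (P - Q) * (-1 - y) by rewrite mulr_ge0 //; chain_lra.
have : 0 < P * ((y + 1) ^+ 2 - y).
  by rewrite mulr_gt0 //; have := sqr_ge0 (y + 1); chain_lra.
chain_lra.
Qed.

(** The chain is cut at this site: it does not act on its neighbours. *)
Lemma rateN1 : r (-1) = 0.
Proof. by rewrite /r /d; field; chain_lra. Qed.

Lemma rate0_lt0 : r 0 < 0.
Proof.
rewrite /r /d expr0n /= mulr0 add0r addr0 mulr1 subr_lt0.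
by rewrite ltr_pdivlMr // mul1r.
Qed.

Lemma chain_norm2_nat_ge (j : nat) : P + 2 * Q <= d j.+1%:Z.
Proof.
rewrite /d; have : (1 : R) <= j.+1%:Z%:~R by rewrite ler1n.
move: (j.+1%:Z%:~R : R) => y y1.
have : 0 <= P * ((y - 1) * (y + 1)) by rewrite mulr_ge0 ?mulr_ge0 //; chain_lra.
have : 0 <= Q * (y - 1) by rewrite mulr_ge0 //; chain_lra.
chain_lra.
Qed.

Lemma rate_nat_ge (j : nat) : 2 * Q / (P + 2 * Q) <= r j.+1%:Z.
Proof.
have h := chain_norm2_nat_ge j; have d0 := chain_norm2_gt0 j.+1%:Z.
rewrite (_ : 2 * Q / _ = 1 - P / (P + 2 * Q)); last by field; chain_lra.
by rewrite lerD2l lerN2 ler_pM2l // lef_pV2 ?posrE //; chain_lra.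
Qed.

Lemma rate_nat_gt0 (j : nat) : 0 < r j.+1%:Z.
Proof.
apply: lt_le_trans (rate_nat_ge j).
by rewrite divr_gt0 //; chain_lra.
Qed.

Lemma rate_le1 n : r n <= 1.
Proof.
rewrite /r lerBlDr lerDl divr_ge0 //; first exact: ltW.
exact: ltW (chain_norm2_gt0 n).
Qed.

Lemma chain_coef_nat_ge lam nu (j : nat) : 0 <= lam -> 0 < nu ->
  nu * P * j.+1%:R ^+ 2 <= a lam nu j.+1%:Z.
Proof.
move=> l0 n0; rewrite /a ler_pdivlMr ?rate_nat_gt0 //.
have y0 : 0 <= nu * P * j.+1%:R ^+ 2.
  by rewrite !mulr_ge0 ?sqr_ge0 // ltW.
apply: le_trans (_ : nu * P * j.+1%:R ^+ 2 * 1 <= _).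
  by rewrite ler_wpM2l // rate_le1.
have : 0 <= nu * (Q * (1 + j.+1%:R)) by rewrite !mulr_ge0 ?addr_ge0 ?ltW.
rewrite /d -pmulrn; chain_lra.
Qed.

Lemma chain_coef_ge_const lam nu (j : nat) : 0 <= lam -> 0 < nu ->
  nu * P <= a lam nu j.+1%:Z.
Proof.
move=> l0 n0; apply: le_trans (chain_coef_nat_ge j l0 n0).
rewrite -[leLHS]mulr1; apply: ler_wpM2l; first exact/ltW/nuP_gt0.
by rewrite exprn_ege1 // ler1n.
Qed.

Lemma dispersion_continuous nu (M : R) : 0 < nu ->
  {within `[0, M], continuous (dispersion ^~ nu)}.
Proof.
move=> nu0; set c := nu * P; have c0 : 0 < c by apply: nuP_gt0.
(* the Lipschitz constant of the fraction, times the largest 1 / rate, plus the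
   slope of the linear term *)
set K := (c ^- 2 + 1) / (1 - two_step_rate c) / (2 * Q / (P + 2 * Q)) + `|(r 0)^-1|.
apply/subspace_continuousP => x /=; rewrite in_itv /= => /andP[x0 xM].
apply/cvgrPdist_lt => e e0.
have K0 : 0 < K.
  rewrite ltr_pwDr // ?normr_gt0 ?invr_eq0 ?lt_eqF ?rate0_lt0 //.
  have ? : 0 < c ^+ 2 by rewrite exprn_gt0.
  have ? : 0 < 1 - two_step_rate c by rewrite subr_gt0 two_step_rate_lt1.
  apply: divr_ge0; last by apply: divr_ge0; chain_lra.
  by apply: divr_ge0; [rewrite addr_ge0 // invr_ge0|]; exact: ltW.
near=> y.
have /andP[y0 yM] : 0 <= y <= M.
  have : [set` `[0, M]] y by near: y; exact: withinT.
  by rewrite /= in_itv.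
apply: (@le_lt_trans _ _ (K * `|x - y|)).
  have -> : dispersion x nu - dispersion y nu = (r 0)^-1 * (x - y) +
     (cfrac (fun j => a x nu j.+1%:Z) - cfrac (fun j => a y nu j.+1%:Z)).
    by rewrite /dispersion /chain_coef; ring.
  apply: le_trans (ler_normD _ _) _.
  rewrite normrM /K mulrDl addrC lerD2r.
  rewrite -[leRHS]mulrA.
  apply: (cfrac_lipschitz c0) => j; do ?exact: chain_coef_ge_const.
  rewrite /chain_coef -mulrBl opprD addrACA subrr addr0 normrM mulrC.
  rewrite ler_wpM2r // ger0_norm ?invr_ge0; last exact/ltW/rate_nat_gt0.
  rewrite lef_pV2 ?posrE ?rate_nat_gt0 ?rate_nat_ge //.
  by rewrite divr_gt0 //; chain_lra.
rewrite mulrC -ltr_pdivlMr //.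
near: y; apply: cvgr_dist_lt; last by rewrite divr_gt0.
exact: cvg_within.
Unshelve. all: by end_near. Qed.

(** The fraction never exceeds 1 / (nu P), and at this lambda the summand
    lambda / rate_0 of the first term equals - 1 / (nu P). *)
Lemma dispersion_neg nu : 0 < nu -> dispersion (- r 0 / (nu * P)) nu < 0.
Proof.
move=> nu0; rewrite /dispersion.
have c0 := nuP_gt0 nu0; have r0 := rate0_lt0.
have l0 : 0 <= - r 0 / (nu * P) by rewrite divr_ge0 ?ltW // oppr_gt0.
have /andP[_ H] := @cfrac_bounds _ _ (fun j => a (- r 0 / (nu * P)) nu j.+1%:Z)
   c0 (fun j => chain_coef_ge_const j l0 nu0).
apply: le_lt_trans (lerD (lexx _) H) _.
rewrite /chain_coef.
rewrite (_ : _ + _ = nu * d 0 / r 0); last first.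
  by field; rewrite (lt_eqF r0) (gt_eqF P0) (gt_eqF nu0).
by rewrite pmulr_rlt0 ?invr_lt0 //; apply: mulr_gt0; last exact: chain_norm2_gt0.
Qed.

(** At lambda = 0 the first term of the dispersion function is - nu C.  If the
    fraction were at most nu C, then the lower bound of [recurrence_second_ge],
    taken with k terms such that k P > 2 C, would push it above nu C, because
    nu^2 A C <= 1/2 for small nu. *)
Lemma dispersion0_gt0 :
  exists2 nu0, 0 < nu0 & forall nu, 0 < nu < nu0 -> 0 < dispersion 0 nu.
Proof.
have r0 := rate0_lt0.
pose C := d 0 / - r 0; have C0 : 0 < C.
  by rewrite divr_gt0 ?oppr_gt0 ?chain_norm2_gt0.
have [k kC] : exists k : nat, 2 * C < k%:R * P.
  exists (Num.bound (2 * C / P)); rewrite -ltr_pdivrMr //.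
  by apply/archi_boundP/ltW; rewrite divr_gt0 // mulr_gt0.
pose A := \sum_(i < k) d i.*2.+1%:Z / r i.*2.+1%:Z.
have A0 : 0 <= A.
  apply: sumr_ge0 => i _; apply/ltW/divr_gt0; first exact: chain_norm2_gt0.
  exact: rate_nat_gt0.
have AC0 : 0 <= A * C by rewrite mulr_ge0 // ltW.
exists (1 + 2 * (A * C))^-1; first by rewrite invr_gt0; chain_lra.
move=> nu /andP[nu0]; rewrite -div1r ltr_pdivlMr; last by chain_lra.
move=> nuAC.
have nuAC2 : 0 <= nu * (A * C) by rewrite mulr_ge0 // ltW.
have c0 := nuP_gt0 nu0.
pose c j := a 0 nu j.+1%:Z.
have cP j : nu * P <= c j by apply: chain_coef_ge_const.
pose x j := cfrac (fun i => c (j + i)%N).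
have x0 j : 0 < x j by apply: (@cfrac_gt0 _ (nu * P)).
have xc j : x j * (c j + x j.+1) = 1 by apply: (@cfrac_tail_step _ (nu * P)).
have zE := prod_tails_recurrence xc; set z := fun j : nat => _ in zE.
have z_ge0 j : 0 <= z j by rewrite prodr_ge0 // => i _; apply: ltW.
have := @recurrence_second_ge _ c z (nu * P) k zE z_ge0
  (fun j => le_trans (ltW c0) (cP j)) (ltW c0) (fun j => cP _).
have -> : z 0 = 1 by rewrite /z big_ord0.
have -> : z 1 = cfrac c by rewrite /z big_ord1.
have -> : \sum_(i < k) c i.*2 = nu * A.
  rewrite mulr_sumr; apply: eq_bigr => i _.
  by rewrite /c /chain_coef add0r mulrA.
have -> : dispersion 0 nu = cfrac c - nu * C.
  rewrite /dispersion -/c /C /chain_coef add0r addrC; congr (_ + _).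
  by rewrite invrN mulrN mulrN opprK mulrA.
rewrite subr_gt0 ltNge => H; apply/negP => fC.
have f0 : 0 < cfrac c by apply: (@cfrac_gt0 _ (nu * P)).
have h1 : nu * A * cfrac c <= 2^-1.
  apply: (@le_trans _ _ (nu * A * (nu * C))).
    by rewrite ler_wpM2l // mulr_ge0 // ltW.
  have : nu * (nu * (A * C)) <= 1 * (nu * (A * C)).
    by rewrite ler_wpM2r //; chain_lra.
  chain_lra.
have h2 : k%:R * (nu * P) * 2^-1 <= k%:R * (nu * P) * (1 - nu * A * cfrac c).
  by rewrite ler_wpM2l ?mulr_ge0 ?(ltW P0) ?(ltW nu0) //; chain_lra.
have : nu * (2 * C) < nu * (k%:R * P) by rewrite ltr_pM2l.
chain_lra.
Qed.

Lemma dispersion_root :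
  exists2 nu0, 0 < nu0 & forall nu, 0 < nu < nu0 ->
    exists2 lam, 0 < lam & dispersion lam nu = 0.
Proof.
have [nu0 nu0_gt0 H] := dispersion0_gt0; exists nu0 => // nu nuI.
have /andP[nu_gt0 _] := nuI.
have D0 := H _ nuI; have D1 := dispersion_neg nu_gt0.
set M := _ / _ in D1.
have M0 : 0 <= M.
  by rewrite divr_ge0 ?(ltW (nuP_gt0 _)) // oppr_ge0 ltW // rate0_lt0.
have [|l lI Dl] := IVT M0 (dispersion_continuous nu_gt0) (v := 0).
  by rewrite ge_min le_max (ltW D0) (ltW D1) orbT.
exists l => //; move: lI; rewrite in_itv /= => /andP[l0 _].
rewrite lt_def l0 andbT; apply/eqP => l_eq.
by move: D0; rewrite -[X in dispersion X]l_eq Dl ltxx.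
Qed.

End Chain.

(** * Eigenvectors on the chain *)

Definition fast_decay {R : realType} (u : int -> R) : Prop :=
  forall m : nat, exists C : R,
    forall n : int, `|u n| * (1 + `|n|%N%:R) ^+ m <= C.

(** Each tail is at most 1 / c_j, of order 1 / j, so passing from j to j + 1
    gains one power of j: a bound of order m for the products implies one of
    order m + 1.  The bound of order 0 is the monotonicity of the products along
    each parity. *)
Lemma prod_fast_decay {R : realType} (c x : nat -> R) (k : R) :
  0 < k -> (forall j, k * j.+1%:R <= c j) -> (forall j, 0 <= x j) ->
  (forall j, x j * (c j + x j.+1) = 1) ->
  forall m : nat, exists C : R,
    forall j : nat, (\prod_(i < j) x i) * (1 + j%:R) ^+ m <= C.
Proof.
move=> k0 ck x0 xc; set z := fun j : nat => \prod_(i < j) x i.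
have zE := prod_tails_recurrence xc.
have z0 j : 0 <= z j by rewrite prodr_ge0.
have c0 j : 0 <= c j by apply: le_trans (ck j); rewrite mulr_ge0 // ltW.
have xk j : x j * (1 + j%:R) <= k^-1.
  rewrite -[leRHS]mul1r ler_pdivlMr // -[leRHS](xc j) -mulrA ler_wpM2l //.
  have := ck j; have := x0 j.+1; rewrite -natr1; lra.
elim=> [|m [C IH]].
  exists (z 0 + z 1) => j; rewrite expr0 mulr1.
  suff [] : z j <= z 0 + z 1 /\ z j.+1 <= z 0 + z 1 by [].
  elim: j => [|j [h1 h2]]; first by split; rewrite ?lerDl ?lerDr.
  split=> //; apply: le_trans h1.
  by rewrite /z (zE j) lerDr mulr_ge0 // z0.
have C0 : 0 <= C by apply: le_trans (IH 0); rewrite mulr_ge0 ?exprn_ge0 ?z0.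
have D0 : 0 <= k^-1 * 2 ^+ m.+1 * C.
  by rewrite !mulr_ge0 // ?exprn_ge0 // invr_ge0 ltW.
exists (1 + k^-1 * 2 ^+ m.+1 * C) => -[|j].
  by rewrite big_ord0 addr0 expr1n mulr1 lerDl.
have j0 : 0 <= 1 + j%:R :> R by rewrite addr_ge0.
apply: le_trans (_ : k^-1 * 2 ^+ m.+1 * C <= _); last by rewrite lerDr.
rewrite big_ord_recr /= -/(z j).
apply: le_trans (_ : z j * x j * (2 * (1 + j%:R)) ^+ m.+1 <= _).
  apply: ler_wpM2l; first by rewrite mulr_ge0.
  rewrite lerXn2r ?nnegrE ?addr_ge0 ?mulr_ge0 //.
  by rewrite -natr1; have := ler0n R j; lra.
rewrite exprMn exprS.
have -> : z j * x j * (2 * 2 ^+ m * (1 + j%:R) ^+ m.+1) =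
  x j * (1 + j%:R) * (2 ^+ m.+1) * (z j * (1 + j%:R) ^+ m) by rewrite !exprS; ring.
rewrite ler_pM // ?mulr_ge0 ?exprn_ge0 //.
  by rewrite -exprS ler_wpM2r // exprn_ge0.
exact: IH.
Qed.

Section ChainEigenvectors.
Context {R : realType}.
Variables (P Q : R).
Hypotheses (Q0 : 0 < Q) (QP : Q < P).
Implicit Types (lam nu : R).

Notation d := (chain_norm2 P Q).
Notation r := (rate P d).
Notation a := (chain_coef P d).

Local Ltac chain_lra := move: Q0 QP; lra.

Let P0 : 0 < P := lt_trans Q0 QP.

(** To the right of site 0 the vector is z_n / rate_n, with z the products of the
    tails of the fraction; the root condition is the equation at site 0, and the
    value at -1 is the one that the equation at -1 forces. *)
Lemma dispersion_root_eigenvector lam nu : 0 < lam -> 0 < nu ->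
  dispersion P Q lam nu = 0 ->
  exists u : int -> R,
    [/\ forall n, chain_op P d nu u n = lam * u n,
        fast_decay u,
        forall n, n < -1 -> u n = 0,
        u (-1) < 0 /\ u 0 < 0
      & forall n, 0 < n -> 0 < u n].
Proof.
move=> lam0 nu0 disp.
have k0 : 0 < nu * P by rewrite mulr_gt0.
pose c (j : nat) := a lam nu j.+1%:Z.
have cP j : nu * P <= c j by apply: chain_coef_ge_const => //; exact: ltW.
pose x (j : nat) := cfrac (fun i => c (j + i)%N).
have x0 j : 0 < x j by apply: (@cfrac_gt0 _ (nu * P)).
have xc j : x j * (c j + x j.+1) = 1 by apply: (@cfrac_tail_step _ (nu * P)).
pose z (j : nat) := \prod_(i < j) x i.
have zE : forall j, z j = c j * z j.+1 + z j.+2 := prod_tails_recurrence xc.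
have z0 j : 0 < z j by rewrite prodr_gt0.
have r0 := rate0_lt0 Q0 QP.
have rj j : 0 < r j.+1%:Z := rate_nat_gt0 Q0 QP j.
have dN1 : 0 < lam + nu * d (-1).
  by rewrite ltr_wpDr // mulr_ge0 // ltW // chain_norm2_gt0.
pose u (n : int) := match n with
  | Posz j => z j / r j%:Z
  | Negz 0 => - (lam + nu * d (-1))^-1
  | Negz _ => 0 end.
have uN n : n < -1 -> u n = 0 by case: n => [j|[|j]] //=; lia.
have succE (j : nat) : j.+1%:Z - 1 = j by rewrite intS addrC addKr.
have predE (j : nat) : j%:Z + 1 = j.+1 by rewrite addrC -intS.
have ru (j : nat) : r j%:Z * u j%:Z = z j.
  by case: j => [|j]; rewrite /u mulrC divfK //; [rewrite lt_eqF|rewrite gt_eqF].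
exists u; split => //.
- case=> [[|j]|[|[|j]]].
  + rewrite /chain_op sub0r rateN1 // mul0r predE ru.
    have : z 1 = - a lam nu 0 * z 0.
      rewrite /z big_ord1 big_ord0 mulr1.
      by apply/eqP; rewrite -addr_eq0 addrC; apply/eqP; exact: disp.
    rewrite -(ru 0) => ->; rewrite /chain_coef; field.
    by rewrite lt_eqF.
  + rewrite /chain_op succE predE !ru (zE j) -(ru j.+1) /c /chain_coef.
    by field; rewrite gt_eqF.
  + rewrite /chain_op (_ : Negz 0 = -1) // addNr (ru 0) (uN (-1 - 1)) //.
    by rewrite /z big_ord0 /=; field; rewrite gt_eqF.
  + rewrite /chain_op (_ : Negz 1 + 1 = -1) // rateN1 // (uN (Negz 1 - 1)) //.
    by rewrite /=; ring.
  + rewrite /chain_op (uN (Negz j.+2 - 1)) ?(uN (Negz j.+2 + 1)) /=; last 2 first.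
    * by lia.
    * by lia.
    ring.
- move=> m; have [C HC] : exists C : R, forall j : nat, z j * (1 + j%:R) ^+ m <= C.
    apply: (prod_fast_decay k0 _ (fun j => ltW (x0 j)) xc) => j.
    apply: le_trans (chain_coef_nat_ge Q0 QP j (ltW lam0) nu0).
    by rewrite ler_wpM2l ?(ltW k0) // ler_eXnr // ler1n.
  have C0 : 0 <= C by apply: le_trans (HC 0); rewrite mulr_ge0 ?exprn_ge0 // ltW.
  have B0 : 0 < 2 * Q / (P + 2 * Q) by rewrite divr_gt0 //; chain_lra.
  set B := 2 * Q / (P + 2 * Q) in B0.
  exists (C * ((- r 0)^-1 + B^-1) + (lam + nu * d (-1))^-1 * 2 ^+ m) => n.
  have E1 : 0 <= C * ((- r 0)^-1 + B^-1).
    by rewrite mulr_ge0 // addr_ge0 // invr_ge0 ?oppr_ge0 ltW.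
  have E2 : 0 <= (lam + nu * d (-1))^-1 * 2 ^+ m.
    by rewrite mulr_ge0 ?exprn_ge0 // invr_ge0 ltW.
  case: n => [j|[|j]] /=.
  + apply: ler_wpDr => //; rewrite normrM (gtr0_norm (z0 j)) mulrAC.
    apply: ler_pM => //; first by rewrite mulr_ge0 ?exprn_ge0 // ltW.
    case: j => [|j].
      by rewrite normrV ?unitfE ?lt_eqF // ltr0_norm // lerDl invr_ge0 ltW.
    rewrite gtr0_norm ?invr_gt0 //; apply: ler_wpDl.
      by rewrite invr_ge0 oppr_ge0 ltW.
    by rewrite lef_pV2 ?posrE // rate_nat_ge.
  + by apply: ler_wpDl => //; rewrite normrN gtr0_norm ?invr_gt0.
  + by rewrite normr0 mul0r addr_ge0.
- split; first by rewrite /u oppr_lt0 invr_gt0.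
  by rewrite /u pmulr_rlt0 // invr_lt0.
- by case=> [[|j]|j] // _; rewrite /u divr_gt0.
Qed.

(** The ratios of consecutive z_n = rate_n u_n are positive and satisfy the
    recursion of the tails, so they are the tails. *)
Lemma eigenvector_dispersion_root lam nu (u : int -> R) : 0 < lam -> 0 < nu ->
  (forall n, chain_op P d nu u n = lam * u n) ->
  u 0 < 0 -> (forall n, 0 < n -> 0 < u n) ->
  dispersion P Q lam nu = 0.
Proof.
move=> lam0 nu0 uE u0 uj.
have k0 : 0 < nu * P by rewrite mulr_gt0.
pose c (j : nat) := a lam nu j.+1%:Z.
have cP j : nu * P <= c j by apply: chain_coef_ge_const => //; exact: ltW.
have r0 := rate0_lt0 Q0 QP.
have rj j : 0 < r j.+1%:Z := rate_nat_gt0 Q0 QP j.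
have succE (j : nat) : j.+1%:Z - 1 = j by rewrite intS addrC addKr.
have predE (j : nat) : j%:Z + 1 = j.+1 by rewrite addrC -intS.
pose z (j : nat) := r j%:Z * u j%:Z.
have z0 j : 0 < z j.
  by case: j => [|j]; rewrite /z; [rewrite nmulr_lgt0|rewrite mulr_gt0 // uj].
have zE j : z j = c j * z j.+1 + z j.+2.
  have := uE j.+1%:Z; rewrite /chain_op succE predE -/(z j) -/(z j.+2) => h.
  have -> : c j * z j.+1 = lam * u j.+1 + nu * d j.+1 * u j.+1.
    by rewrite /c /z /chain_coef; field; rewrite gt_eqF.
  by rewrite -h; ring.
pose x (j : nat) := z j.+1 / z j.
have xc j : x j * (c j + x j.+1) = 1.
  rewrite /x; have -> : z j.+1 / z j * (c j + z j.+2 / z j.+1) =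
     (c j * z j.+1 + z j.+2) / z j.
    by field; rewrite !gt_eqF.
  by rewrite -zE mulfV // gt_eqF.
rewrite /dispersion -/c.
rewrite (@cfrac_uniq _ _ c x k0 cP (fun j => ltW (divr_gt0 (z0 _) (z0 _))) xc).
have := uE 0; rewrite /chain_op sub0r rateN1 // mul0r predE -/(z 1) => h.
have -> : chain_coef P d lam nu 0 = (lam * u 0 + nu * d 0 * u 0) / z 0.
  by rewrite /chain_coef /z; field; rewrite !lt_eqF.
by rewrite -h /x; field; rewrite gt_eqF.
Qed.

End ChainEigenvectors.

(** * Membership in the weighted spaces *)

Section Summability.
Context {R : realType}.

Let inv_sqr_partial_sum (N : nat) :
  \sum_(i < N) (i.+1%:R ^+ 2)^-1 <= 2 - 2 * N.+1%:R^-1 :> R.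
Proof.
elim: N => [|N IH]; first by rewrite big_ord0 invr1 mulr1 subrr.
rewrite big_ord_recr /=; apply: le_trans (lerD IH (lexx _)) _.
have y1 : 1 <= N.+1%:R :> R by rewrite ler1n.
rewrite -[N.+2%:R]natr1; move: (N.+1%:R : R) y1 => y y1.
rewrite -subr_ge0; have -> : 2 - 2 * (y + 1)^-1 - (2 - 2 * y^-1 + (y ^+ 2)^-1) =
  (y - 1) / (y ^+ 2 * (y + 1)) by field; lra.
by rewrite divr_ge0 ?mulr_ge0 ?sqr_ge0 //; lra.
Qed.

Lemma esum_inv_sqr_fin (I : choiceType) (e : nat -> I) (a : I -> \bar R) C :
  injective e -> (forall i, 0%E <= a i)%E ->
  (forall j, (a (e j) <= (C * (j.+1%:R ^+ 2)^-1)%:E)%E) ->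
  (\esum_(i in range e) a i < +oo)%E.
Proof.
move=> e_inj a0 aC.
have C0 : 0 <= C.
  by have := le_trans (a0 _) (aC 0); rewrite lee_fin expr1n invr1 mulr1.
rewrite esum_image; last by move=> ? ? _ _; exact: e_inj.
rewrite -nneseries_esumT //.
apply: le_lt_trans (ltry (C * 2)).
apply: lime_le; first exact: is_cvg_nneseries.
apply: nearW => N.
apply: (@le_trans _ _ (\sum_(0 <= i < N) (C * (i.+1%:R ^+ 2)^-1)%:E)%E).
  by apply: lee_sum => i _.
rewrite sumEFin lee_fin big_mkord -mulr_sumr ler_wpM2l //.
apply: le_trans (inv_sqr_partial_sum N) _.
by rewrite gerBl mulr_ge0 // invr_ge0.
Qed.

(** Replaces the real exponent of the weights by a natural one, so that
    [fast_decay] applies. *)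
Lemma powR_weight_le (s t T : R) (m : nat) :
  0 <= 2 * s <= m%:R -> 0 <= t -> t <= T -> 1 <= T ->
  0 <= 1 + t `^ (2 * s) <= 2 * T ^+ m.
Proof.
move=> /andP[s0 sm] t0 tT T1; have T0 : 0 <= T by apply: le_trans tT.
rewrite addr_ge0 ?powR_ge0 //=.
have h1 : t `^ (2 * s) <= T `^ (2 * s) by rewrite ge0_ler_powR ?nnegrE.
have h2 : T `^ (2 * s) <= T ^+ m.
  by rewrite -powR_mulrn // ler_powR.
have h3 : 1 <= T ^+ m by rewrite exprn_ege1.
lra.
Qed.

(** Stated for a chain e embedded in an arbitrary index set, so that it serves
    both the sequences on the chain and their extensions to the lattice. *)
Lemma l2w_fast_decay (I : choiceType) (weight : I -> R) (e : int -> I)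
    (w : I -> R[i]) (u : int -> R) (K : R) (m : nat) :
  injective e -> (forall n, w (e n) = (u n)%:C) ->
  (forall i, ~ range e i -> w i = 0) -> fast_decay u ->
  (forall i, 0 <= weight i) ->
  (forall n, weight (e n) <= K * (1 + `|n|%N%:R) ^+ m) ->
  l2w weight w.
Proof.
move=> e_inj we w0 u_decay wt0 wtK; rewrite /l2w /=.
set a := fun i => (weight i * ComplexField.Normc.normc (w i) ^+ 2)%:E.
have a0 i : (0 <= a i)%E by rewrite lee_fin mulr_ge0 ?sqr_ge0.
have -> : (\esum_(i in setT) a i = \esum_(i in range e) a i)%E.
  rewrite [RHS]esum_mkcond; apply: eq_esum => i _.
  case: ifPn => //; rewrite notin_setE /a => /w0 ->.
  by rewrite ComplexField.Normc.normc0 expr0n mulr0.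
have [C HC] : exists C, forall n, (a (e n) <= (C * ((1 + `|n|%N%:R) ^+ 2)^-1)%:E)%E.
  have [C1 H1] := u_decay (m + 2)%N; have [C2 H2] := u_decay 0.
  exists (K * (C1 * C2)) => n; rewrite lee_fin we.
  have -> : ComplexField.Normc.normc (u n)%:C ^+ 2 = `|u n| * `|u n|.
    by rewrite /= expr0n addr0 sqrtr_sqr expr2.
  rewrite ler_pdivlMr ?exprn_gt0 ?ltr_pwDl //.
  have K0 : 0 <= K * (1 + `|n|%N%:R) ^+ m by apply: le_trans (wtK n).
  have y0 : 0 < 1 + `|n|%N%:R :> R by rewrite ltr_pwDl.
  have {}K0 : 0 <= K by move: K0; rewrite pmulr_lge0 // exprn_gt0.
  have := H1 n; have := H2 n; rewrite expr0 mulr1 exprD.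
  move: (wtK n); set y := 1 + _ => h h2 h1.
  apply: (@le_trans _ _ (K * y ^+ m * (`|u n| * `|u n|) * y ^+ 2)).
    rewrite ler_wpM2r ?sqr_ge0 // ler_wpM2r // mulr_ge0 //.
  have -> : K * y ^+ m * (`|u n| * `|u n|) * y ^+ 2 =
     K * ((`|u n| * (y ^+ m * y ^+ 2)) * `|u n|) by ring.
  by rewrite ler_wpM2l // ler_pM // mulr_ge0 // mulr_ge0 // exprn_ge0 // ltW.
have -> : range e = (range (e \o Posz)) `|` (range (e \o Negz)).
  apply/seteqP; split=> [_ [[j|j] _ <-]|_ [[j _ <-]|[j _ <-]]].
  - by left; exists j.
  - by right; exists j.
  - by exists (Posz j).
  - by exists (Negz j).
rewrite (esumID (range (e \o Posz))) // setUK.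
rewrite lte_add_pinfty //.
  apply: (@esum_inv_sqr_fin _ _ _ C) => // [j k /e_inj []//|j].
  by have := HC (Posz j); rewrite /= nat1r.
apply: le_lt_trans (_ : \esum_(i in range (e \o Negz)) a i < +oo)%E.
  have -> : ((range (e \o Posz) `|` range (e \o Negz)) `&` ~` range (e \o Posz))
     = range (e \o Negz) `\` range (e \o Posz).
    by rewrite -setDE setDUl setDv set0U.
  rewrite [leRHS](esumID (range (e \o Posz))) // -setDE.
  by rewrite leeDr // esum_ge0.
apply: (@esum_inv_sqr_fin _ _ _ C) => // [j k /e_inj []//|j].
apply: le_trans (HC (Negz j)) _; rewrite lee_fin /=.
have C0 : 0 <= C.
  by have := le_trans (a0 _) (HC 0); rewrite lee_fin addr0 expr1n invr1 mulr1.
rewrite ler_wpM2l // lef_pV2 ?posrE ?exprn_gt0 ?ltr_pwDl //.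
rewrite lerXn2r ?nnegrE ?addr_ge0 //.
by rewrite lerDr.
Qed.

End Summability.

(** * Reflection of the chain *)

Section Reflection.
Context {R : realType}.
Implicit Types (u : int -> R) (n : int).

Definition flip u n : R := (-1) ^+ absz n * u (- n).

Lemma sign_absz_pred n : (-1) ^+ absz (n - 1) = - (-1) ^+ absz n :> R.
Proof.
case: n => [[|j]|j].
- by rewrite sub0r expr0 expr1.
- by rewrite intS addrC addKr [in RHS]/= exprS mulN1r opprK.
- have -> : Negz j - 1 = Negz j.+1 by lia.
  by rewrite /= exprS mulN1r.
Qed.

Lemma sign_absz_succ n : (-1) ^+ absz (n + 1) = - (-1) ^+ absz n :> R.
Proof. by rewrite -[in RHS](addrK 1 n) sign_absz_pred opprK. Qed.

(** Reversing the chain exchanges the two neighbour terms, which have opposite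
    signs; the alternating factor in [flip] restores them. *)
Lemma chain_op_flip (P : R) (d : int -> R) nu u n :
  chain_op P (fun k => d (- k)) nu (flip u) n =
  (-1) ^+ absz n * chain_op P d nu u (- n).
Proof.
rewrite /chain_op /flip /rate sign_absz_pred sign_absz_succ.
have -> : - (n - 1) = - n + 1 by lia.
have -> : - (n + 1) = - n - 1 by lia.
ring.
Qed.

Lemma flip_fast_decay u : fast_decay u -> fast_decay (flip u).
Proof.
move=> u_decay m; have [C HC] := u_decay m; exists C => n.
by rewrite /flip normrM normr_sign mul1r -abszN.
Qed.

Lemma chain_opN (P : R) (d : int -> R) nu u n :
  chain_op P d nu (fun k => - u k) n = - chain_op P d nu u n.
Proof. by rewrite /chain_op; ring. Qed.

End Reflection.

(** * From the chain to the lattice *)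

Lemma fst_mulrz (x : Z2) (n : int) : (x *~ n).1 = x.1 * n.
Proof. by rewrite (raddfMz (@fst int int)) -mulrzz. Qed.

Lemma snd_mulrz (x : Z2) (n : int) : (x *~ n).2 = x.2 * n.
Proof. by rewrite (raddfMz (@snd int int)) -mulrzz. Qed.

Section Transport.
Context {R : realType}.
Variables (p q : Z2) (Gamma : R) (d : int -> R).

Notation site n := (q + p *~ n).
Notation P := (enorm R p ^+ 2).

Hypothesis p_neq0 : p != 0.
Hypothesis siteE : forall n, enorm R (site n) ^+ 2 = d n.
Hypothesis d_gt0 : forall n, 0 < d n.
Hypothesis norm_Gamma : Gamma * (wedge q p)%:~R / (2 * P) = 1.

(** The normalization of Gamma is exactly what removes Gamma and the wedge
    product from the weights. *)
Lemma rho_rate n : rho p q Gamma n = rate P d n.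
Proof.
have dn0 : d n != 0 by rewrite gt_eqF.
have p_norm0 : enorm R p != 0 by rewrite -sqrf_eq0 sqr_enorm_neq0.
have site_neq0 : site n != 0.
  apply: contraNneq dn0 => s0.
  by rewrite -siteE s0 sqr_enorm /= expr0n addr0.
rewrite /rho /beta p_neq0 site_neq0 /= siteE /rate.
have -> : (wedge p (site n))%:~R = - (wedge q p)%:~R :> R.
  rewrite -rmorphN; congr (_%:~R); rewrite /wedge /= fst_mulrz snd_mulrz; ring.
have -> : Gamma * (2^-1 * ((d n)^-1 - P^-1) * - (wedge q p)%:~R) =
  - (Gamma * (wedge q p)%:~R / (2 * P)) * (P / d n - 1).
  by field; rewrite dn0 p_norm0.
by rewrite norm_Gamma; ring.
Qed.

Lemma LBq_realE nu (u : int -> R) n :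
  LBq p q Gamma nu (fun k => (u k)%:C) n = (chain_op P d nu u n)%:C.
Proof. by rewrite /LBq /chain_op !rho_rate siteE -!rmorphM -!rmorphB. Qed.

(** The coefficients are real, so the real part of a complex eigenvector for a
    real eigenvalue solves the real equation. *)
Lemma Re_LBq nu (w : int -> R[i]) n :
  complex.Re (LBq p q Gamma nu w n) =
  chain_op P d nu (fun k => complex.Re (w k)) n.
Proof.
have ReZ (x : R) (y : R[i]) : complex.Re (x%:C * y) = x * complex.Re y.
  by case: y => y1 y2; rewrite /= mul0r subr0.
have ReB (x y : R[i]) : complex.Re (x - y) = complex.Re x - complex.Re y.
  by case: x; case: y.
by rewrite /LBq /chain_op !rho_rate siteE !ReB !ReZ.
Qed.

Lemma site_inj : injective (fun n => site n).
Proof.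
move=> m n /addrI /eqP; rewrite -subr_eq0 -mulrzBr => /eqP e.
apply/eqP; rewrite -subr_eq0; apply: contraNT p_neq0 => mn.
have := congr1 fst e; have := congr1 snd e; rewrite fst_mulrz snd_mulrz /=.
move=> /eqP + /eqP; rewrite !mulf_eq0 (negPf mn) !orbF => p2 p1.
by rewrite [p]surjective_pairing (eqP p1) (eqP p2).
Qed.

Definition extend_by0 (u : int -> R) (k : Z2) : R[i] :=
  if pselect (exists n, k = site n) is left h then (u (projT1 (cid h)))%:C
  else 0.

Lemma extend_by0_site u n : extend_by0 u (site n) = (u n)%:C.
Proof.
rewrite /extend_by0; case: pselect => [h|[]]; last by exists n.
by case: (cid h) => m /= /site_inj ->.
Qed.

Lemma extend_by0_out u k : ~ (exists n, k = site n) -> extend_by0 u k = 0.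
Proof. by rewrite /extend_by0; case: pselect. Qed.

Lemma LB_extend_by0 nu u n :
  LB p Gamma nu (extend_by0 u) (site n) = (chain_op P d nu u n)%:C.
Proof.
rewrite -LBq_realE /LB /LBq.
have -> : site n - p = site (n - 1) by rewrite mulrzBr mulr1z addrA.
have -> : site n + p = site (n + 1) by rewrite mulrzDr mulr1z addrA.
by rewrite !extend_by0_site /rho ![_ * Gamma]mulrC.
Qed.

Lemma LB_extend_by0_out nu u k : ~ (exists n, k = site n) ->
  LB p Gamma nu (extend_by0 u) k = 0.
Proof.
move=> kN; rewrite /LB !extend_by0_out ?mulr0 ?subr0 //.
- case=> n kE; apply: kN; exists (n - 1).
  by rewrite mulrzBr mulr1z addrA -kE addrK.
- case=> n kE; apply: kN; exists (n + 1).
  by rewrite mulrzDr mulr1z addrA -kE subrK.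
Qed.

Section Eigenvectors.
Variables (D nu lam : R) (u : int -> R).
Hypothesis d_le : forall n, d n <= D * (1 + `|n|%N%:R) ^+ 2.
Hypothesis u_decay : fast_decay u.
Hypothesis u_neq0 : exists n, u n != 0.
Hypothesis u_eigen : forall n, chain_op P d nu u n = lam * u n.

Let fast_decayZ (c : R) : fast_decay (fun n => c * u n).
Proof.
move=> m; have [C HC] := u_decay m; exists (`|c| * C) => n.
by rewrite normrM -mulrA ler_wpM2l.
Qed.

Let natpow (s : R) : 0 <= s -> exists m : nat, 0 <= 2 * s <= m%:R.
Proof.
move=> s0; exists (Num.bound (2 * s)).
by rewrite mulr_ge0 //= ltW // archi_boundP // mulr_ge0.
Qed.

Let l2Z_mem s (c : R) : 0 <= s -> l2Z s (fun n => (c * u n)%:C).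
Proof.
move=> s0; have [m sm] := natpow s0.
apply: (@l2w_fast_decay _ _ _ id _ (fun n => c * u n) 2 m).
- by [].
- by [].
- by move=> i []; exists i.
- exact: fast_decayZ.
- by move=> n; rewrite addr_ge0 // powR_ge0.
- move=> n; have nE : `|n%:~R : R| = `|n|%N%:R by rewrite -intr_norm -abszE.
  suff /andP[_] : 0 <= 1 + `|n%:~R : R| `^ (2 * s) <= 2 * (1 + `|n|%N%:R) ^+ m by [].
  by apply: powR_weight_le; rewrite ?nE ?lerDl ?lerDr.
Qed.

Let l2Z2_mem s (c : R) : 0 <= s -> l2Z2 s (extend_by0 (fun n => c * u n)).
Proof.
move=> s0; have [m sm] := natpow s0.
have D0 : 0 <= D.
  by have := le_trans (ltW (d_gt0 0)) (d_le 0); rewrite addr0 expr1n mulr1.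
apply: (@l2w_fast_decay _ _ _ (fun n => site n) _ (fun n => c * u n)
  (2 * (1 + D) ^+ m) (2 * m)).
- exact: site_inj.
- exact: extend_by0_site.
- by move=> k kN; apply: extend_by0_out => -[n kE]; apply: kN; exists n.
- exact: fast_decayZ.
- by move=> n; rewrite addr_ge0 // powR_ge0.
- move=> n; have y1 : 1 <= 1 + `|n|%N%:R :> R by rewrite lerDl.
  rewrite exprM -mulrA -exprMn.
  move: (d_le n) y1; set y := 1 + _ => dn y1.
  have y21 : 1 <= y ^+ 2 by rewrite exprn_ege1.
  suff /andP[_] : 0 <= 1 + enorm R (site n) `^ (2 * s) <=
    2 * ((1 + D) * y ^+ 2) ^+ m by [].
  apply: powR_weight_le => //; first by rewrite sqrtr_ge0.
  + have : 0 <= (enorm R (site n) - 1) ^+ 2 by rewrite sqr_ge0.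
    have : 0 <= enorm R (site n) by rewrite sqrtr_ge0.
    by move: dn; rewrite -siteE; nra.
  + have : 0 <= D * y ^+ 2 by rewrite mulr_ge0 // sqr_ge0.
    lra.
Qed.

Lemma chain_eigenvector_LBq s : 0 <= s ->
  is_eigenvector (l2Z s) (LBq p q Gamma nu) lam%:C (fun n => (u n)%:C).
Proof.
move=> s0; have E n : LBq p q Gamma nu (fun k => (u k)%:C) n = (lam * u n)%:C.
  by rewrite LBq_realE u_eigen.
split.
- split.
    by have := @l2Z_mem s 1 s0; under [X in l2Z s X]eq_fun do rewrite mul1r.
  by rewrite (funext E); apply: l2Z_mem.
- have [n un] := u_neq0; exists n; apply: contraNneq un => /(congr1 (@complex.Re _)).
  by move=> /= ->.
- by move=> n; rewrite E rmorphM.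
Qed.

Lemma chain_eigenvector_LB s : 0 <= s ->
  is_eigenvector (l2Z2 s) (LB p Gamma nu) lam%:C (extend_by0 u).
Proof.
move=> s0.
have E k : LB p Gamma nu (extend_by0 u) k = extend_by0 (fun n => lam * u n) k.
  have [[n ->]|kN] := pselect (exists n, k = site n).
    by rewrite LB_extend_by0 u_eigen extend_by0_site.
  by rewrite LB_extend_by0_out // extend_by0_out.
split.
- split.
    by have := @l2Z2_mem s 1 s0; under [X in extend_by0 X]eq_fun do rewrite mul1r.
  by rewrite (funext E); apply: l2Z2_mem.
- have [n un] := u_neq0; exists (site n); rewrite extend_by0_site.
  by apply: contraNneq un => /(congr1 (@complex.Re _)) /= ->.
- move=> k; rewrite E; have [[n ->]|kN] := pselect (exists n, k = site n).
    by rewrite !extend_by0_site rmorphM.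
  by rewrite !extend_by0_out // mulr0.
Qed.

End Eigenvectors.

End Transport.

(** * Geometry of points of type I *)

Section Geometry.
Context {R : realType}.
Implicit Types (p q : Z2) (n : int).

Lemma sqr_enorm_site p q n : enorm R (q + p *~ n) ^+ 2 =
  enorm R q ^+ 2 + 2 * n%:~R * (p.1 * q.1 + p.2 * q.2)%:~R
  + n%:~R ^+ 2 * enorm R p ^+ 2.
Proof.
rewrite !sqr_enorm /= fst_mulrz snd_mulrz.
by rewrite !(rmorphD, rmorphM) /=; ring.
Qed.

Lemma type_I_lt p q : type_I R p q -> enorm R q ^+ 2 < enorm R p ^+ 2.
Proof.
case=> _ /(_ q) [_ /(_ erefl) [_ h]].
by rewrite ltrXn2r ?nnegrE ?sqrtr_ge0.
Qed.

Lemma not_parallel_neq0 p q : ~ parallel R p q -> 0 < enorm R q ^+ 2.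
Proof.
move=> npar; rewrite lt_def sqr_ge0 andbT; apply: sqr_enorm_neq0.
by apply/eqP => q0; apply: npar; exists 0; rewrite q0 !mul0r.
Qed.

(** |q - p| = |p| means 2 p.q = |q|^2, which determines all norms on the line. *)
Lemma type_Iminus_norm2 p q n : type_Iminus R p q ->
  enorm R (q + p *~ n) ^+ 2 = chain_norm2 (enorm R p ^+ 2) (enorm R q ^+ 2) n.
Proof.
case=> _ h; rewrite sqr_enorm_site /chain_norm2.
have -> : 2 * n%:~R * (p.1 * q.1 + p.2 * q.2)%:~R =
    n%:~R * (2 * (p.1 * q.1 + p.2 * q.2)%:~R) :> R by ring.
have -> : 2 * (p.1 * q.1 + p.2 * q.2)%:~R = enorm R q ^+ 2.
  have := sqr_enorm_site p q (-1); rewrite mulrN1z h rmorphN rmorph1.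
  by rewrite sqrrN expr1n; lra.
by ring.
Qed.

Lemma type_Iplus_norm2 p q n : type_Iplus R p q ->
  enorm R (q + p *~ n) ^+ 2 =
  chain_norm2 (enorm R p ^+ 2) (enorm R q ^+ 2) (- n).
Proof.
case=> _ h; rewrite sqr_enorm_site /chain_norm2 rmorphN.
have -> : 2 * n%:~R * (p.1 * q.1 + p.2 * q.2)%:~R =
    n%:~R * (2 * (p.1 * q.1 + p.2 * q.2)%:~R) :> R by ring.
have -> : 2 * (p.1 * q.1 + p.2 * q.2)%:~R = - enorm R q ^+ 2.
  have := sqr_enorm_site p q 1; rewrite mulr1z h rmorph1 expr1n; lra.
by ring.
Qed.

Lemma chain_norm2_le (P Q : R) n : 0 <= P -> 0 <= Q ->
  chain_norm2 P Q n <= (P + Q) * (1 + `|n|%N%:R) ^+ 2.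
Proof.
move=> P0 Q0; rewrite /chain_norm2.
have h : (n%:~R : R) <= `|n|%N%:R.
  by rewrite -[leRHS]/((Posz `|n|%N)%:~R) abszE intr_norm ler_norm.
have e : (n%:~R : R) ^+ 2 = `|n|%N%:R ^+ 2.
  by rewrite -[X in _ = X ^+ 2]/((Posz `|n|%N)%:~R) abszE intr_norm real_normK ?num_real.
rewrite e; move: (n%:~R : R) (`|n|%N%:R : R) h (ler0n R `|n|%N) => x y xy y0.
have : 0 <= Q * (y - x) by rewrite mulr_ge0 ?subr_ge0.
have : 0 <= Q * (y ^+ 2 + y) by rewrite mulr_ge0 ?addr_ge0 ?sqr_ge0.
have : 0 <= P * (1 + 2 * y) by rewrite mulr_ge0 ?addr_ge0 ?mulr_ge0.
lra.
Qed.

End Geometry.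

(** * The steady state *)

Section SteadyState.
Context {R : realType}.
Implicit Types (p : Z2) (Gamma nu : R).

Lemma cosD2piz (x : R) (n : int) : cos (x + n%:~R * (2 * pi)) = cos x.
Proof.
have N (m : nat) (y : R) : cos (y + m%:R * (2 * pi)) = cos y.
  by rewrite -[RHS](periodicn (@cosD2pi R) m y) -[pi *+ 2]mulr_natl mulr_natl.
case: n => m; first exact: N.
by rewrite NegzE rmorphN mulNr -[LHS](N m.+1) subrK.
Qed.

(** The stream function is omega0 / |p|^2; velocity and vorticity gradient are
    orthogonal because both depend on the phase p.x only. *)
Lemma steady_state_omega0 p Gamma nu : p != 0 ->
  steady_state nu (forcing p Gamma) (u0 p Gamma) (omega0 p Gamma).
Proof.
move=> p0.
have pn0 : enorm R p != 0 by rewrite -sqrf_eq0 sqr_enorm_neq0.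
have omegaE : omega0 p Gamma = trig p Gamma 0.
  by apply/funext => x; apply/funext => y; rewrite /trig /omega0 mul0r addr0.
split.
  exists (trig p (Gamma / enorm R p ^+ 2) 0); split.
  - move=> x y; rewrite /trig !mul0r !addr0 /phase.
    split; congr (_ * _).
      by rewrite -[RHS](cosD2piz _ p.1); congr (cos _); ring.
    by rewrite -[RHS](cosD2piz _ p.2); congr (cos _); ring.
  - exact: has_partials_trig.
  - apply/funext => x; apply/funext => y.
    rewrite /u0 /vel dx_trig dy_trig /trig rmorphN /=.
    by congr (_, _); ring.
  - rewrite omegaE; apply/funext => x; apply/funext => y.
    by rewrite /vort lap_trig /trig; field.
move=> x y; rewrite omegaE lap_trig /advect dx_trig dy_trig /u0 /trig /forcing.
by rewrite rmorphN /=; ring.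
Qed.

End SteadyState.

(** * Sign properties *)

Section Signs.
Context {R : realType}.
Implicit Types (u : int -> R) (w : int -> R[i]).

Let ltc0R (x : R) : (x%:C < 0) = (x < 0). Proof. exact: ltcR. Qed.
Let gtc0R (x : R) : (0 < x%:C) = (0 < x). Proof. exact: ltcR. Qed.

Let Re_lt0 (z : R[i]) : z < 0 -> complex.Re z < 0.
Proof. by rewrite ltcE => /andP[]. Qed.
Let Re_gt0 (z : R[i]) : 0 < z -> 0 < complex.Re z.
Proof. by rewrite ltcE => /andP[]. Qed.

Lemma sign_minus0_real u : (forall n, n < -1 -> u n = 0) ->
  u (-1) < 0 /\ u 0 < 0 -> (forall n, 0 < n -> 0 < u n) ->
  sign_minus0 (fun n => (u n)%:C).
Proof.
move=> uN [u1 u0] up; split; rewrite ?ltc0R // => n n0.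
  by rewrite uN.
by rewrite gtc0R up.
Qed.

Lemma sign_plus0_flip u : (forall n, n < -1 -> u n = 0) ->
  u (-1) < 0 /\ u 0 < 0 -> (forall n, 0 < n -> 0 < u n) ->
  sign_plus0 (fun n => (flip u n)%:C).
Proof.
move=> uN [u1 u0] up; rewrite /flip; split.
- by move=> n n1; rewrite uN ?mulr0 //; lia.
- by rewrite gtc0R expr1 mulN1r oppr_gt0.
- by rewrite !ltc0R oppr0 opprK expr0 expr1 mul1r mulN1r oppr_lt0 up.
- move=> n n2; have -> : (-1) ^+ `|n|%N = ((-1) ^+ `|n|%N : R)%:C :> R[i].
    by rewrite rmorphXn rmorphN1.
  by rewrite -rmorphM gtc0R mulrA -expr2 sqrr_sign mul1r up //; lia.
Qed.

Lemma sign_minus0_Re w : sign_minus0 w ->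
  complex.Re (w 0) < 0 /\ forall n, 0 < n -> 0 < complex.Re (w n).
Proof. by case=> _ [_ w0] wp; split=> [|n n0]; auto. Qed.

Lemma sign_plus0_Re w : sign_plus0 w ->
  let v := flip (fun n => complex.Re (w n)) in
  v 0 < 0 /\ forall n, 0 < n -> 0 < v n.
Proof.
case=> _ _ [w1 w0] wn; split.
  by rewrite /flip oppr0 expr0 mul1r Re_lt0.
have Re_sign (k : nat) (z : R[i]) :
    complex.Re ((-1) ^+ k * z) = (-1) ^+ k * complex.Re z.
  have -> : (-1) ^+ k = ((-1) ^+ k : R)%:C :> R[i] by rewrite rmorphXn rmorphN1.
  by case: z => x y; rewrite /= mul0r subr0.
case=> [[|[|j]]|j] // _.
  by rewrite /flip expr1 mulN1r oppr_gt0 Re_lt0.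
rewrite /flip -Re_sign Re_gt0 // -abszN; apply: wn; lia.
Qed.

End Signs.

(** * Instability *)

Section Conclusion.
Context {R : realType}.
Variables (p q : Z2) (Gamma : R).

Notation P := (enorm R p ^+ 2).
Notation Q := (enorm R q ^+ 2).

(** What has to be shown for one viscosity, with the sign property and the
    characteristic equation abstracted so that both types share it. *)
Definition instability (nu : R) (sign : (int -> R[i]) -> Prop)
    (root : R -> Prop) : Prop :=
  [/\ steady_state nu (forcing p Gamma) (u0 p Gamma) (omega0 p Gamma),
      forall s : R, 0 <= s ->
        [/\ linearly_unstable s p Gamma nu,
            exists2 lam : R, 0 < lam &
              is_eigenvalue (l2Z s) (LBq p q Gamma nu) lam%:C
          & exists2 lam : R, 0 < lam &
              is_eigenvalue (l2Z2 s) (LB p Gamma nu) lam%:C]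
    & forall s : R, 0 <= s -> forall lam : R, 0 < lam ->
        (exists2 w, is_eigenvector (l2Z s) (LBq p q Gamma nu) lam%:C w
                  & sign w)
        <-> root lam].

(** Everything follows from a correspondence, on the real chain, between roots of
    the characteristic equation and rapidly decaying eigenvectors with the
    required signs. *)
Lemma unstable_of_chain (d : int -> R) (D nu : R)
    (sign : (int -> R[i]) -> Prop) (root : R -> Prop) :
  p != 0 ->
  (forall n, enorm R (q + p *~ n) ^+ 2 = d n) -> (forall n, 0 < d n) ->
  Gamma * (wedge q p)%:~R / (2 * P) = 1 ->
  (forall n, d n <= D * (1 + `|n|%N%:R) ^+ 2) ->
  (forall lam, 0 < lam -> root lam -> exists u,
     [/\ forall n, chain_op P d nu u n = lam * u n, fast_decay u,
         exists n, u n != 0 & sign (fun n => (u n)%:C)]) ->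
  (forall lam w, 0 < lam ->
     (forall n, chain_op P d nu (fun k => complex.Re (w k)) n =
                lam * complex.Re (w n)) ->
     sign w -> root lam) ->
  (exists2 lam, 0 < lam & root lam) ->
  instability nu sign root.
Proof.
move=> p0 siteE d0 nG dD to_vec of_vec [lam lam0 rlam].
have ReZ (x : R) (y : R[i]) : complex.Re (x%:C * y) = x * complex.Re y.
  by case: y => y1 y2; rewrite /= mul0r subr0.
split; first exact: steady_state_omega0.
- move=> s s0; have [u [uE udec un0 _]] := to_vec _ lam0 rlam.
  have eig : is_eigenvalue (l2Z2 s) (LB p Gamma nu) lam%:C.
    exists (extend_by0 p q u).
    exact: (chain_eigenvector_LB p0 siteE d0 nG dD).
  split; [by exists lam%:C|exists lam => //|by exists lam].
  exists (fun n => (u n)%:C).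
  exact: (chain_eigenvector_LBq p0 siteE d0 nG).
- move=> s s0 mu mu0; split=> [[w [_ _ wE] sw]|rmu].
    apply: (of_vec _ w mu0) => // n.
    by rewrite -(Re_LBq p0 siteE d0 nG) wE ReZ.
  have [u [uE udec un0 su]] := to_vec _ mu0 rmu.
  exists (fun n => (u n)%:C) => //.
  exact: (chain_eigenvector_LBq p0 siteE d0 nG).
Qed.

Hypothesis p_neq0 : p != 0.
Hypothesis Q0 : 0 < Q.
Hypothesis QP : Q < P.
Hypothesis norm_Gamma : Gamma * (wedge q p)%:~R / (2 * P) = 1.

Let P0 : 0 < P := lt_trans Q0 QP.

Let cf_chain_cvg lam nu : 0 < lam -> 0 < nu ->
  cf_converges (fun j => chain_coef P (chain_norm2 P Q) lam nu j.+1%:Z).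
Proof.
move=> lam0 nu0; apply: (@cf_cvg _ (nu * P)); first by rewrite mulr_gt0.
by move=> j; apply: chain_coef_ge_const => //; exact: ltW.
Qed.

Lemma solves_minusE lam nu : type_Iminus R p q -> 0 < lam -> 0 < nu ->
  solves_minus p q Gamma nu lam <-> dispersion P Q lam nu = 0.
Proof.
move=> I lam0 nu0; have siteE n := type_Iminus_norm2 n I.
have aE n : a_ p q Gamma n lam nu = chain_coef P (chain_norm2 P Q) lam nu n.
  by rewrite /a_ (rho_rate p_neq0 siteE (chain_norm2_gt0 Q0 QP) norm_Gamma) siteE.
have fE : f_coef p q Gamma lam nu =
    fun j => chain_coef P (chain_norm2 P Q) lam nu j.+1%:Z.
  by apply/funext => j; rewrite /f_coef aE.
rewrite /solves_minus fE aE.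
by split=> [[]//|disp]; split=> //; exact: cf_chain_cvg.
Qed.

Lemma solves_plusE lam nu : type_Iplus R p q -> 0 < lam -> 0 < nu ->
  solves_plus p q Gamma nu lam <-> dispersion P Q lam nu = 0.
Proof.
move=> I lam0 nu0; have siteE n := type_Iplus_norm2 n I.
have d0 n : 0 < chain_norm2 P Q (- n) by exact: chain_norm2_gt0.
have aE n : a_ p q Gamma n lam nu = chain_coef P (chain_norm2 P Q) lam nu (- n).
  by rewrite /a_ (rho_rate p_neq0 siteE d0 norm_Gamma) siteE.
have gE : g_coef p q Gamma lam nu =
    fun j => chain_coef P (chain_norm2 P Q) lam nu j.+1%:Z.
  by apply/funext => j; rewrite /g_coef aE opprK.
rewrite /solves_plus gE aE oppr0.
by split=> [[]//|disp]; split=> //; exact: cf_chain_cvg.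
Qed.

Lemma chain_eigen_Re_neg (d : int -> R) nu lam (w : int -> R[i]) :
  (forall n, chain_op P d nu (fun k => complex.Re (w k)) n =
     lam * complex.Re (w n)) ->
  forall n, chain_op P d nu (fun k => complex.Re (- w k)) n =
     lam * complex.Re (- w n).
Proof.
have ReN (z : R[i]) : complex.Re (- z) = - complex.Re z by case: z.
move=> wE n; rewrite ReN mulrN -wE -chain_opN.
by congr chain_op; apply/funext => k.
Qed.

Lemma type_Iminus_unstable nu : type_Iminus R p q -> 0 < nu ->
  (exists2 lam, 0 < lam & dispersion P Q lam nu = 0) ->
  instability nu (@sign_minus R) (solves_minus p q Gamma nu).
Proof.
move=> I nu0 [lam lam0 disp].
have siteE n := type_Iminus_norm2 n I.
apply: (unstable_of_chain p_neq0 siteE (chain_norm2_gt0 Q0 QP) norm_Gamma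
          (D := P + Q)).
- by move=> n; apply: chain_norm2_le; exact: ltW.
- move=> mu mu0 /(solves_minusE I mu0 nu0).
  move=> /(dispersion_root_eigenvector Q0 QP mu0 nu0)[u [uE udec uN u0 up]].
  exists u; split=> //; first by exists 0; rewrite lt_eqF //; case: u0.
  by left; apply: sign_minus0_real.
- move=> mu w mu0 wE sw; apply/(solves_minusE I mu0 nu0).
  case: sw => /sign_minus0_Re [w0 wp].
    exact: (eigenvector_dispersion_root Q0 QP mu0 nu0 wE w0 wp).
  exact: (eigenvector_dispersion_root Q0 QP mu0 nu0
            (chain_eigen_Re_neg wE) w0 wp).
- by exists lam => //; apply/(solves_minusE I lam0 nu0).
Qed.

(** [flip] turns the solutions of the reflected chain into solutions of the chain
    of type I_- and back. *)
Lemma type_Iplus_unstable nu : type_Iplus R p q -> 0 < nu ->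
  (exists2 lam, 0 < lam & dispersion P Q lam nu = 0) ->
  instability nu (@sign_plus R) (solves_plus p q Gamma nu).
Proof.
move=> I nu0 [lam lam0 disp].
have siteE n := type_Iplus_norm2 n I.
pose d n := chain_norm2 P Q (- n).
have dE : chain_norm2 P Q = fun n => d (- n).
  by apply/funext => n; rewrite /d opprK.
have d0 n : 0 < d n by exact: chain_norm2_gt0.
apply: (unstable_of_chain p_neq0 siteE d0 norm_Gamma (D := P + Q)).
- move=> n; rewrite -abszN; apply: chain_norm2_le; exact: ltW.
- move=> mu mu0 /(solves_plusE I mu0 nu0).
  move=> /(dispersion_root_eigenvector Q0 QP mu0 nu0)[u [uE udec uN u0 up]].
  exists (flip u); split.
  + by move=> n; rewrite chain_op_flip uE /flip mulrCA.
  + exact: flip_fast_decay.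
  + by exists 0; rewrite /flip expr0 mul1r oppr0 lt_eqF //; case: u0.
  + by left; apply: sign_plus0_flip.
- move=> mu w mu0 wE sw; apply/(solves_plusE I mu0 nu0).
  have flipE v : (forall n, chain_op P d nu v n = mu * v n) ->
      forall n, chain_op P (chain_norm2 P Q) nu (flip v) n = mu * flip v n.
    by move=> vE n; rewrite dE chain_op_flip vE /flip mulrCA.
  case: sw => /sign_plus0_Re [w0 wp].
    exact: (eigenvector_dispersion_root Q0 QP mu0 nu0 (flipE _ wE) w0 wp).
  exact: (eigenvector_dispersion_root Q0 QP mu0 nu0
            (flipE _ (chain_eigen_Re_neg wE)) w0 wp).
- by exists lam => //; apply/(solves_plusE I lam0 nu0).
Qed.

End Conclusion.

Unset Implicit Arguments.

Theorem theorem2p13 (R : realType) (p q : Z2) (Gamma : R) :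
  p != 0 ->
  (type_Iplus R p q \/ type_Iminus R p q) ->
  ~ parallel R p q ->
  Gamma * (wedge q p)%:~R / (2 * enorm R p ^+ 2) = 1 ->
  exists nu0p nu0m : R,
  [/\ 0 < nu0p,
      0 < nu0m,
      type_Iplus R p q -> forall nu : R, 0 < nu < nu0p ->
        [/\ steady_state nu (forcing p Gamma) (u0 p Gamma) (omega0 p Gamma),
            forall s : R, 0 <= s ->
              [/\ linearly_unstable s p Gamma nu,
                  exists2 lam : R, 0 < lam &
                    is_eigenvalue (l2Z s) (LBq p q Gamma nu) lam%:C
                & exists2 lam : R, 0 < lam &
                    is_eigenvalue (l2Z2 s) (LB p Gamma nu) lam%:C]
          & forall s : R, 0 <= s -> forall lam : R, 0 < lam ->
              (exists2 w, is_eigenvector (l2Z s) (LBq p q Gamma nu) lam%:C w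
                        & sign_plus w)
              <-> solves_plus p q Gamma nu lam]
    & type_Iminus R p q -> forall nu : R, 0 < nu < nu0m ->
        [/\ steady_state nu (forcing p Gamma) (u0 p Gamma) (omega0 p Gamma),
            forall s : R, 0 <= s ->
              [/\ linearly_unstable s p Gamma nu,
                  exists2 lam : R, 0 < lam &
                    is_eigenvalue (l2Z s) (LBq p q Gamma nu) lam%:C
                & exists2 lam : R, 0 < lam &
                    is_eigenvalue (l2Z2 s) (LB p Gamma nu) lam%:C]
          & forall s : R, 0 <= s -> forall lam : R, 0 < lam ->
              (exists2 w, is_eigenvector (l2Z s) (LBq p q Gamma nu) lam%:C w
                        & sign_minus w)
              <-> solves_minus p q Gamma nu lam]].
Proof.
move=> p0 I npar nG.
have Q0 : 0 < enorm R q ^+ 2 by apply: not_parallel_neq0 npar.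
have QP : enorm R q ^+ 2 < enorm R p ^+ 2.
  by case: I => -[I _]; exact: type_I_lt I.
have [nu0 nu0_gt0 root] := dispersion_root Q0 QP.
exists nu0, nu0; split=> // J nu /[dup] /andP[nu_gt0 _] /root disp.
- exact: type_Iplus_unstable.
- exact: type_Iminus_unstable.
Qed.
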